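(* Let $\pi$ be an arbitrary set of prime numbers. Then the pseudovariety $\overline{\mathsf{G}_\pi}$ is $\kappa_\pi$-reducible for pointlike sets and also $\kappa_\pi$-reducible for idempotent pointlike sets. In particular, the pseudovariety $\mathsf{A}$ of all finite aperiodic semigroups is $\kappa$-reducible for both pointlike sets and idempotent pointlike sets.
   Context: $\mathsf{S}$ is the pseudovariety of all finite semigroups, and for a finite set $A$, $\overline{\Omega}_A\mathsf{S}$ is the free profinite semigroup on $A$; its elements are called pseudowords. For a pseudovariety $\mathsf{V}$ of semigroups, $\overline{\Omega}_A\mathsf{V}$ is the free pro-$\mathsf{V}$ semigroup on $A$ and $p_{\mathsf{V}}:\overline{\Omega}_A\mathsf{S}\to\overline{\Omega}_A\mathsf{V}$ is the canonical projection. A $\pi$-group is a finite group whose order factors into primes from $\pi$; $\mathsf{G}_\pi$ is the pseudovariety of all finite $\pi$-groups. For a pseudovariety $\mathsf{H}$ of groups, $\overline{\mathsf{H}}$ is the pseudovariety of all finite semigroups all of whose subgroups lie in $\mathsf{H}$. Thus $\overline{\mathsf{G}_\emptyset}=\mathsf{A}$. An implicit signature is a set $\sigma$ of pseudowords (elements of finitely generated free profinite semigroups, viewed as implicit operations) that contains binary multiplication (which is omitted when listing the members). Pseudowords have a natural interpretation as operations on every profinite semigroup, so every profinite semigroup is a $\sigma$-algebra; $\Omega^\sigma_A\mathsf{S}$ is the $\sigma$-subalgebra of $\overline{\Omega}_A\mathsf{S}$ generated by $A$. The signature $\kappa$ consists of (multiplication and) the unary operation $x\mapsto x^{\omega-1}$,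 which in a finite semigroup maps $x$ to the inverse of $x^{\omega+1}=x^\omega x$ in the maximal subgroup with identity $x^\omega$, where $x^\omega$ is the unique idempotent power of $x$. Let $\widehat{\mathbb{Z}_+}$ be the profinite completion of the additive semigroup of positive integers. For $\nu\in\widehat{\mathbb{Z}_+}$ and $s$ in a profinite semigroup $T$, $s^\nu$ is the image of $\nu$ under the unique continuous homomorphism $\widehat{\mathbb{Z}_+}\to T$ mapping $1$ to $s$; $\omega=\lim n!\in\widehat{\mathbb{Z}_+}$. If $\pi=\emptyset$, put $\nu_\pi=\omega+1$; otherwise $\nu_\pi$ is any (fixed) accumulation point in $\widehat{\mathbb{Z}_+}$ of the sequence $((p_1\cdots p_n)^{n!})_n$, where $p_1,p_2,\ldots$ is an enumeration of $\pi$, possibly with repetitions. (Here $\nu_\pi-1$ denotes $\nu_\pi+(\omega-1)$.) The implicit signature $\kappa_\pi$ is obtained from $\kappa$ by adding the unary operations $x\mapsto x^\mu$, if not already expressible by an $\omega$-term, for all $\mu\in\widehat{\mathbb{Z}_+}$ for which there exists $k\in\mathbb{Z}_+$ with $k(\mu+1)=\nu_\pi-1$. A nonempty subset $P$ of a finite semigroup $S$ is $\mathsf{V}$-pointlike (respectively $\mathsf{V}$-idempotent pointlike) if for every finite set $A$ and every onto continuous homomorphism $\varphi:\overline{\Omega}_A\mathsf{S}\to S$ there is a subset $P'\subseteq\overline{\Omega}_A\mathsf{S}$ such that $\varphi(P')=P$ and $p_{\mathsf{V}}(P')$ is a singleton (respectively a singleton consisting of an idempotent). The pseudovariety $\mathsf{V}$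 is $\sigma$-reducible for pointlike sets (respectively idempotent pointlike sets) if, for every finite semigroup $S$, every $\mathsf{V}$-pointlike (respectively $\mathsf{V}$-idempotent pointlike) subset $P$ of $S$ and every such $\varphi$, the set $P'$ can be chosen to be a subset of $\Omega^\sigma_A\mathsf{S}$. *)

(* Defs.v *)
From HB Require Import structures.
From Stdlib Require List.
From mathcomp Require Import all_boot fingroup.
From mathcomp Require Import all_classical.
From mathcomp Require Import topology.

Set Implicit Arguments.
Unset Strict Implicit.
Unset Printing Implicit Defensive.

Local Open Scope classical_set_scope.
Local Open Scope group_scope.

Record finSemigroup := FinSemigroup {
  fsg_car : finType;
  fsg_mul : fsg_car -> fsg_car -> fsg_car;
  fsg_mulA : associative fsg_mul }.

Definition fsg_sort (S : finSemigroup) : predArgType := fsg_car S.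
Coercion fsg_sort : finSemigroup >-> predArgType.
HB.instance Definition _ (S : finSemigroup) :=
  Finite.copy (fsg_sort S) (fsg_car S).
HB.instance Definition _ (S : finSemigroup) :=
  isSemigroup.Build (fsg_sort S) (@fsg_mulA S).

Definition fsg_class := finSemigroup -> Prop.
Definition allS : fsg_class := fun _ => True.

(* The subgroups of S (with any idempotent of S as identity) are the images of
   the injective semigroup homomorphisms from finite groups to S. *)
Definition overline (H : finGroupType -> Prop) : fsg_class :=
  fun S => forall (G : finGroupType) (i : {multiplicative G -> S}),
    injective i -> H G.

Definition G_ (pi : set nat) (G : finGroupType) : Prop :=
  [pred p | p \in pi].-nat #|G|.

Definition aperiodic : fsg_class := overline (fun G => #|G| = 1%N).

(* spow x n is x^n, for n >= 1 *)
Definition spow (T : semigroupType) (x : T) (n : nat) : T :=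
  iter n.-1 ( *%g x) x.

Lemma spowS (T : semigroupType) (x : T) n : 0 < n -> spow x n.+1 = x * spow x n.
Proof. by case: n. Qed.

Lemma spowD (T : semigroupType) (x : T) m n : 0 < m -> 0 < n ->
  spow x (m + n) = spow x m * spow x n.
Proof.
case: m => // m _ n0; elim: m => [|m IHm]; first by rewrite add1n spowS.
by rewrite addSn spowS ?addn_gt0 // IHm mulgA -spowS.
Qed.

(* The free semigroup A^+: the pair (a, s) is the nonempty word a :: s. *)
Definition word (A : Type) : Type := (A * seq A)%type.
HB.instance Definition _ (A : choiceType) := Choice.on (word A).

Section Word.
Variable A : choiceType.

Definition word_mul (u v : word A) : word A := (u.1, u.2 ++ v.1 :: v.2).

Lemma word_mulA : associative word_mul.
Proof. by move=> u v w; rewrite /word_mul /= -catA. Qed.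

HB.instance Definition _ := isSemigroup.Build (word A) word_mulA.

Definition letter (a : A) : word A := (a, [::]).

Variables (T : semigroupType) (t : A -> T).

Definition word_ext (u : word A) : T := foldl (fun x b => x * t b) (t u.1) u.2.

Lemma word_extM : {morph word_ext : u v / u * v}.
Proof.
move=> [a s] [b r]; rewrite /word_ext /= foldl_cat /=.
elim/last_ind: r => [|r c IHr] //=.
by rewrite -!cats1 !foldl_cat /= IHr mulgA.
Qed.

HB.instance Definition _ := isMultiplicative.Build _ _ word_ext word_extM.

End Word.

(* The additive semigroup of positive integers; its operation is addition, but
   it is written * as in every other semigroup. *)
Definition Zplus : Type := {n : nat | 0 < n}.
HB.instance Definition _ := Choice.on Zplus.

Definition Zplus_add (m n : Zplus) : Zplus :=
  exist _ (val m + val n)%N (ltn_addr _ (valP m)).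

Lemma Zplus_addA : associative Zplus_add.
Proof. by move=> m n p; apply: val_inj; rewrite /= addnA. Qed.

HB.instance Definition _ := isSemigroup.Build Zplus Zplus_addA.

(* posn n is n if n > 0; the junk value posn 0 is 1. *)
Definition posn (n : nat) : Zplus := insubd (exist _ 1%N isT) n.

Lemma posnK n : 0 < n -> val (posn n) = n.
Proof. by move=> n0; rewrite /posn val_insubd n0. Qed.

Lemma posnD m n : 0 < m -> 0 < n -> posn (m + n) = posn m * posn n.
Proof.
by move=> m0 n0; apply: val_inj; rewrite /= !posnK // addn_gt0 m0.
Qed.

Definition Zplus_pow (T : semigroupType) (x : T) (n : Zplus) : T :=
  spow x (val n).

Lemma Zplus_powM (T : semigroupType) (x : T) :
  {morph Zplus_pow x : m n / m * n}.
Proof. by move=> [m m0] [n n0]; rewrite /Zplus_pow spowD. Qed.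

HB.instance Definition _ (T : semigroupType) (x : T) :=
  isMultiplicative.Build _ _ (Zplus_pow x) (@Zplus_powM T x).

(* The pro-V completion of a semigroup M is the projective limit, over all
   homomorphisms f : M -> T with T in V, of the discrete semigroups T. When V is
   closed under subsemigroups the surjective f are cofinal, so this is also the
   limit of the quotients of M that lie in V. For the limit to be taken over a
   small category, T ranges over the finite semigroups with carrier 'I_n, which
   represent all finite semigroups up to isomorphism; V is meant to be closed
   under isomorphism. *)
Section Completion.
Variables (V : fsg_class) (M : semigroupType).

Record findex := Findex {
  fi_n : nat;
  fi_mul : 'I_fi_n -> 'I_fi_n -> 'I_fi_n;
  fi_mulA : associative fi_mul;
  fi_mem : V (FinSemigroup fi_mulA);
  fi_hom : {multiplicative M -> FinSemigroup fi_mulA} }.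

Definition fi_sg (i : findex) : finSemigroup := FinSemigroup (@fi_mulA i).

Record completion := Completion {
  coords :> forall i : findex, discrete_topology (fi_sg i);
  coords_nat : forall (i j : findex) (g : {multiplicative fi_sg i -> fi_sg j}),
    (forall m, fi_hom j m = g (fi_hom i m)) -> coords j = g (coords i) }.

Lemma completion_eq (x y : completion) : (forall i, x i = y i) -> x = y.
Proof.
case: x y => [x xP] [y yP] /= xy.
have {}xy : x = y by apply: functional_extensionality_dep.
by subst y; congr Completion; apply: Prop_irrelevance.
Qed.

HB.instance Definition _ := gen_eqMixin completion.
HB.instance Definition _ := gen_choiceMixin completion.
HB.instance Definition _ :=
  Topological.copy completion (initial_topology (coords : completion ->
    prod_topology (fun i : findex => discrete_topology (fi_sg i)))).

Definition completion_mul (x y : completion) : completion.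
Proof.
exists (fun i => (x i : fi_sg i) * (y i : fi_sg i)) => i j g ij.
by rewrite gmulfM -!coords_nat.
Defined.

Lemma completion_mulA : associative completion_mul.
Proof. by move=> x y z; apply: completion_eq => i /=; rewrite mulgA. Qed.

HB.instance Definition _ := isSemigroup.Build completion completion_mulA.

(* canonical homomorphism from M to its completion *)
Definition eta (m : M) : completion :=
  @Completion (fun i => fi_hom i m) (fun i j g ij => ij m).

Lemma etaM : {morph eta : m n / m * n}.
Proof. by move=> m n; apply: completion_eq => i /=; rewrite gmulfM. Qed.

HB.instance Definition _ := isMultiplicative.Build _ _ eta etaM.

Definition coord (i : findex) (x : completion) : fi_sg i := x i.

Lemma coordM i : {morph coord i : x y / x * y}.
Proof. by []. Qed.

HB.instance Definition _ i := isMultiplicative.Build _ _ (coord i) (coordM i).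

(* x and y agree on the finitely many coordinates listed in s *)
Definition agree (s : seq findex) (x y : completion) : Prop :=
  forall i, List.In i s -> y i = x i.

Lemma nbhs_completion (x : completion) (A : set completion) :
  nbhs x A <-> exists s, agree s x `<=` A.
Proof.
pose F : set_system completion := [set B | exists s, agree s x `<=` B].
have FF : Filter F.
  split; first by exists [::].
    move=> B C [s sB] [t tC]; exists (s ++ t) => y yst; split.
      by apply: sB => i si; apply: yst; apply/List.in_app_iff; left.
    by apply: tC => i si; apply: yst; apply/List.in_app_iff; right.
  by move=> B C BC [s sB]; exists s; apply: subset_trans BC.
split; last first.
  move=> [s sA]; apply: (filterS sA) => {sA}; elim: s => [|i s IHs].
    by apply: (@filterS _ _ _ setT); [move=> y _ i []|exact: filterT].
  have ix : nbhs x [set y : completion | y i = x i].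
    apply: (@initial_continuous completion _ (coords : completion ->
      prod_topology (fun i : findex => discrete_topology (fi_sg i)))
      x [set f | f i = x i]).
    have /cvg_sup/(_ i) xi := @cvg_id _ (nbhs (coords x : prod_topology
      (fun i : findex => discrete_topology (fi_sg i)))).
    have := xi [set f | f i = x i]; apply.
    exists [set f | f i = x i]; split => //.
    by exists [set x i] => //; exact: discrete_open.
  apply: filterS (filterI ix IHs) => y [/= yi ys] j [<-//|]; exact: ys.
suff FX : F --> x by apply: FX.
move=> B [_ [[C Cop <-] Cx CB]]; apply: filterS CB _.
have : (coords @ F) --> (coords x : prod_topology
    (fun i : findex => discrete_topology (fi_sg i))).
  apply/cvg_sup => i D [_ [[E Eop <-] Ex ED]]; apply: filterS ED _.
  by exists [:: i] => y yx /=; rewrite /= yx //; left.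
by apply; rewrite nbhsE; exists C.
Qed.

Lemma coord_continuous i : continuous (coord i : _ -> discrete_topology _).
Proof.
move=> x A /principal_filterP Ax; apply/nbhs_completion; exists [:: i] => y.
by move=> /(_ i (or_introl erefl)) yx; rewrite /preimage /= /coord yx.
Qed.

Lemma completion_continuous (X : topologicalType) (h : X -> completion) :
  (forall i, continuous (coord i \o h : X -> discrete_topology _)) ->
  continuous h.
Proof.
move=> hc x A /nbhs_completion [s sA].
have {}sA : nbhs x (h @^-1` agree s (h x)) -> nbhs x (h @^-1` A).
  by apply: filterS => y; exact: sA.
apply: sA; elim: s => [|i s IHs]; first
  by apply: (@filterS _ _ _ setT); [move=> y _ i []|exact: filterT].
have hi : nbhs x [set y | h y i = h x i].
  exact: hc i x [set coord i (h x)] (discrete_set1 _).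
apply: filterS (filterI hi IHs) => y [/= yi ys] j [<-//|]; exact: ys.
Qed.

End Completion.

Arguments eta V {M} m.

(* the canonical projection p_V from the profinite to the pro-V completion *)
Section Projection.
Variables (V : fsg_class) (M : semigroupType).

Definition forget_mem (i : findex V M) : findex allS M :=
  @Findex allS M (fi_n i) _ (@fi_mulA _ _ i) I (fi_hom i).

Definition pV (x : completion allS M) : completion V M :=
  @Completion V M (fun i => x (forget_mem i))
    (fun i j g ij => @coords_nat _ _ x (forget_mem i) (forget_mem j) g ij).

Lemma pVM : {morph pV : x y / x * y}.
Proof. by move=> x y; apply: completion_eq. Qed.

Lemma pV_eta m : pV (eta allS m) = eta V m.
Proof. exact: completion_eq. Qed.

Lemma pV_continuous : continuous pV.
Proof.
by apply: completion_continuous => i; exact: (@coord_continuous _ _ (forget_mem i)).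
Qed.

End Projection.

(* The continuous extension to completions of a homomorphism h from M to
   a completion;
   cext_unique shows that it is the only one. *)
Section Extension.
Variables (V : fsg_class) (M N : semigroupType).
Variable h : {multiplicative M -> completion V N}.

Definition ext_index (i : findex V N) : findex V M :=
  @Findex V M (fi_n i) _ (@fi_mulA _ _ i) (fi_mem i) (coord i \o h).

Definition cext (x : completion V M) : completion V N :=
  @Completion V N (fun i => x (ext_index i))
    (fun i j g ij => @coords_nat _ _ x (ext_index i) (ext_index j) g
      (fun m => @coords_nat _ _ (h m) i j g ij)).

Lemma cextM : {morph cext : x y / x * y}.
Proof. by move=> x y; apply: completion_eq. Qed.

Lemma cext_eta m : cext (eta V m) = h m.
Proof. exact: completion_eq. Qed.

Lemma cext_continuous : continuous cext.
Proof.
by apply: completion_continuous => i; exact: (@coord_continuous _ _ (ext_index i)).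
Qed.

End Extension.

Section MkHom.
Variables (S T : semigroupType) (f : S -> T).
Hypothesis fM : {morph f : x y / x * y}.
Definition mkhom : {multiplicative S -> T} :=
  HB.pack_for (Multiplicative.type S T) f (isMultiplicative.Build S T f fM).
End MkHom.

(* ev f is the continuous extension to the completion of the homomorphism f from
   M to an arbitrary finite semigroup T. *)
Section Evaluation.
Variable M : semigroupType.

Section Ord.
Variable T : finSemigroup.

Definition ord_mul (a b : 'I_#|T|) : 'I_#|T| :=
  enum_rank (enum_val a * enum_val b : T).

Lemma ord_mulA : associative ord_mul.
Proof. by move=> a b c; rewrite /ord_mul !enum_rankK mulgA. Qed.

Definition ord_sg : finSemigroup := FinSemigroup ord_mulA.

Lemma to_ordM : {morph (fun x : T => enum_rank x : ord_sg) : x y / x * y}.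
Proof. by move=> x y; rewrite /mul /= /ord_mul !enum_rankK. Qed.

Lemma of_ordM : {morph (fun a : ord_sg => enum_val a : T) : x y / x * y}.
Proof. by move=> x y; rewrite /mul /= /ord_mul !enum_rankK. Qed.

Variable f : {multiplicative M -> T}.

Definition ord_index : findex allS M :=
  @Findex allS M #|T| ord_mul ord_mulA I (mkhom to_ordM \o f).

Definition ev (x : completion allS M) : T := enum_val (x ord_index).

Lemma evM : {morph ev : x y / x * y}.
Proof. by move=> x y; exact: of_ordM. Qed.

Lemma ev_eta m : ev (eta allS m) = f m.
Proof. by rewrite /ev /= enum_rankK. Qed.

Lemma ev_continuous : continuous (ev : _ -> discrete_topology T).
Proof.
move=> x A /principal_filterP Ax; apply/nbhs_completion.
exists [:: ord_index] => y /(_ _ (or_introl erefl)) yx.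
by rewrite /preimage /= /ev yx.
Qed.

End Ord.

Lemma ev_nat (T T' : finSemigroup) (f : {multiplicative M -> T})
    (f' : {multiplicative M -> T'}) (g : {multiplicative T -> T'}) x :
  (forall m, f' m = g (f m)) -> ev f' x = g (ev f x).
Proof.
move=> ff'; rewrite /ev.
pose g' := mkhom (@to_ordM T') \o (g \o mkhom (@of_ordM T)).
rewrite (@coords_nat _ _ x (ord_index f) (ord_index f') g').
  by rewrite /= enum_rankK.
by move=> m /=; rewrite enum_rankK ff'.
Qed.

Lemma coord_ev (i : findex allS M) (x : completion allS M) : x i = ev (fi_hom i) x.
Proof.
rewrite /ev (@coords_nat _ _ x i (ord_index (fi_hom i))
  (mkhom (@to_ordM (fi_sg i)))) //.
by rewrite enum_rankK.
Qed.

Lemma ev_image (T : finSemigroup) (f : {multiplicative M -> T}) x :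
  exists m, ev f x = f m.
Proof.
pose P := [pred t : T | `[< exists m, f m = t >]].
have Pmul (a b : {t | P t}) : P (val a * val b).
  have /asboolP[m mE] := valP a; have /asboolP[n nE] := valP b.
  by apply/asboolP; exists (m * n); rewrite gmulfM mE nE.
pose mulI (a b : {t | P t}) : {t | P t} := @exist T (fun t => P t) _ (Pmul a b).
have mulIA : associative mulI by move=> a b c; apply: val_inj; exact: mulgA.
pose I := FinSemigroup mulIA.
have Pf m : P (f m) by apply/asboolP; exists m.
pose f' (m : M) : I := @exist T (fun t => P t) _ (Pf m).
have f'M : {morph f' : x y / x * y}.
  by move=> u v; apply: val_inj; rewrite /= gmulfM.
have valM : {morph (fun a : I => val a : T) : x y / x * y} by [].
rewrite (@ev_nat I T (mkhom f'M) f (mkhom valM)) //=.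
by have /asboolP[m <-] := valP (ev (mkhom f'M) x); exists m.
Qed.

Lemma ev_joint (s : seq (findex allS M)) :
  exists (T : finSemigroup) (f : {multiplicative M -> T}),
  forall i, List.In i s -> exists g : {multiplicative T -> fi_sg i},
    forall m, fi_hom i m = g (f m).
Proof.
elim: s => [|i s [T [f fP]]].
  have uA : associative (fun _ _ : unit => tt) by [].
  pose U := FinSemigroup uA.
  have cM : {morph (fun _ : M => tt : U) : x y / x * y} by [].
  by exists U, (mkhom cM).
pose T2 := (T * fi_sg i)%type.
pose mul2 (a b : T2) : T2 := (a.1 * b.1, a.2 * b.2).
have mul2A : associative mul2 by move=> a b c; rewrite /mul2 /= !mulgA.
pose S := FinSemigroup mul2A.
have fM : {morph (fun m : M => (f m, fi_hom i m) : S) : x y / x * y}.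
  by move=> u v; rewrite !gmulfM.
have p1M : {morph (fun a : S => a.1 : T) : x y / x * y} by [].
have p2M : {morph (fun a : S => a.2 : fi_sg i) : x y / x * y} by [].
exists S, (mkhom fM) => j [<-|js]; first by exists (mkhom p2M).
have [g gP] := fP j js; exists (g \o mkhom p1M) => m; exact: gP.
Qed.

Lemma eta_dense : dense (range (eta allS : M -> _)).
Proof.
move=> A [x Ax] Aop.
have /nbhs_completion[s sA] : nbhs x A by apply: open_nbhs_nbhs.
have [T [f fP]] := ev_joint s; have [m fm] := ev_image f x.
exists (eta allS m); split; last by exists m.
apply: sA => i /fP[g gP].
by rewrite !coord_ev !(ev_nat _ gP) fm ev_eta.
Qed.

(* two continuous maps to a discrete space that agree on M are equal *)
Lemma eta_unique (T : choiceType)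
    (u v : completion allS M -> discrete_topology T) :
  continuous u -> continuous v ->
  (forall m, u (eta allS m) = v (eta allS m)) -> u = v.
Proof.
move=> uc vc uv; apply: funext => x.
pose A := u @^-1` [set u x] `&` v @^-1` [set v x].
have Aop : open A.
  by apply: openI; [move/continuousP: uc | move/continuousP: vc]; apply;
    exact: discrete_open.
have Ax : A x by [].
have [y [[yu yv] [m _ mE]]] := @eta_dense A (ex_intro _ x Ax) Aop.
by rewrite -[u x]yu -[v x]yv -mE uv.
Qed.

Lemma cext_unique (N : semigroupType) (h : {multiplicative M -> completion allS N})
    (u : completion allS M -> completion allS N) :
  continuous u -> (forall m, u (eta allS m) = h m) -> u = cext h.
Proof.
move=> uc uh; apply: funext => x; apply: completion_eq => i.
have cc (v : completion allS M -> completion allS N) : continuous v ->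
    continuous (coord i \o v : _ -> discrete_topology _).
  move=> vc y; apply: continuous_comp; [exact: vc | exact: coord_continuous].
have := eta_unique (cc _ uc) (cc _ (@cext_continuous _ _ _ h)).
move=> /(_ _)/(congr1 (fun k => k x)); apply => m.
exact: (congr1 (coord i) (etrans (uh m) (esym (cext_eta h m)))).
Qed.

End Evaluation.

(* The profinite completion of Zplus. Its operation, written *, is addition. *)
Notation Zhat := (completion allS Zplus).

Definition zhat (n : nat) : Zhat := eta allS (posn n).

Lemma pow_period (T : finSemigroup) (f : {multiplicative Zplus -> T}) :
  exists i p, [/\ 0 < i <= #|T|, 0 < p <= #|T| & forall a b,
    i <= a -> i <= b -> a = b %[mod p] -> f (posn a) = f (posn b)].
Proof.
pose u (k : 'I_#|T|.+1) := f (posn k.+1).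
have /injectivePn[k0 [l0 nkl ukl]] : ~~ injectiveb u.
  apply/negP => /injectiveP/leq_card; rewrite card_ord; by rewrite ltnn.
wlog lt_kl : k0 l0 nkl ukl / k0 < l0.
  move=> W; move: (nkl); rewrite -val_eqE neq_ltn => /orP[/W|/W]; first exact.
  by apply; rewrite 1?eq_sym.
have {}ukl : f (posn k0.+1) = f (posn l0.+1) := ukl.
exists k0.+1, (l0 - k0)%N.
have per m : k0 < m -> f (posn (m + (l0 - k0))) = f (posn m).
  move=> km; have [->|ltkm] : m = k0.+1 \/ k0.+1 < m.
  - by move: km; rewrite leq_eqVlt => /orP[/eqP <-|->]; [left|right].
  - by rewrite addSn subnKC 1?ltnW.
  have d0 : 0 < m - k0.+1 by rewrite subn_gt0.
  rewrite -[in RHS](subnK (ltnW ltkm)) -[in LHS](subnK (ltnW ltkm)) -addnA.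
  by rewrite [(k0.+1 + _)%N]addSn subnKC 1?ltnW // !posnD // !gmulfM ukl.
have perM m c : k0 < m -> f (posn (m + c * (l0 - k0))) = f (posn m).
  move=> km; elim: c => [|c IHc]; first by rewrite mul0n addn0.
  by rewrite mulSn [(_ - _ + _)%N]addnC addnA per ?IHc // ltn_addr.
split.
- exact: leq_trans lt_kl (ltn_ord l0).
- by rewrite subn_gt0 lt_kl /= (leq_trans (leq_subr _ _)) // -ltnS ltn_ord.
move=> a b; wlog le_ab : a b / a <= b.
  by move=> W ka kb ab; case/orP: (leq_total a b) => le; [|symmetry]; apply: W.
move=> ka kb /eqP; rewrite eq_sym eqn_mod_dvd // => /dvdnP[c cE].
by rewrite -(subnKC le_ab) cE perM.
Qed.

(* a criterion for a sequence of positive integers to converge in Zhat *)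
Definition stable (u : nat -> nat) : Prop := forall m n, m <= n ->
  [/\ 0 < u n, m <= u n & forall p, 0 < p <= m -> u n = u m %[mod p]].

Lemma stable_eq (T : finSemigroup) (f : {multiplicative Zplus -> T}) u n :
  stable u -> #|T| <= n -> f (posn (u n)) = f (posn (u #|T|)).
Proof.
move=> us Tn; have [i [p [/andP[_ iT] pT fP]]] := pow_period f.
have [_ un uP] := us _ _ Tn; have [_ uT _] := us _ _ (leqnn #|T|).
by apply: fP; [apply: leq_trans un | apply: leq_trans uT | apply: uP].
Qed.

Lemma zlim_nat u (us : stable u) (i j : findex allS Zplus)
    (g : {multiplicative fi_sg i -> fi_sg j}) :
  (forall m, fi_hom j m = g (fi_hom i m)) ->
  fi_hom j (posn (u #|fi_sg j|)) = g (fi_hom i (posn (u #|fi_sg i|))).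
Proof.
move=> ij; pose n := maxn #|fi_sg i| #|fi_sg j|.
have := @stable_eq (fi_sg i) (fi_hom i) u n us (leq_maxl _ _).
have := @stable_eq (fi_sg j) (fi_hom j) u n us (leq_maxr _ _).
by move=> <- <-; exact: ij.
Qed.

Definition zlim u (us : stable u) : Zhat :=
  @Completion allS Zplus (fun i => fi_hom i (posn (u #|fi_sg i|)))
    (@zlim_nat u us).

Lemma zlim_cvg u (us : stable u) : (fun n => zhat (u n)) @ \oo --> zlim us.
Proof.
move=> A /nbhs_completion[s sA].
suff [n0 n0P] : exists n0, forall n, n0 <= n ->
    forall i, List.In i s -> coords (zhat (u n)) i = coords (zlim us) i.
  by exists n0 => // n /= /n0P; exact: sA.
elim: s {sA} => [|i s [n0 n0P]]; first by exists 0.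
exists (maxn n0 #|fi_sg i|) => n; rewrite geq_max => /andP[n0n in_] j [<-|js].
  exact: (@stable_eq (fi_sg i) (fi_hom i)).
exact: n0P.
Qed.

Lemma fact_stable : stable factorial.
Proof.
move=> m n mn; split; [exact: fact_gt0 | exact: leq_trans mn (fact_geq n) |].
move=> p /andP[p0 pm]; apply/eqP.
by rewrite !(eqP (dvdn_fact _)) // p0 // (leq_trans pm).
Qed.

Lemma fact_pred_stable : stable (fun n => (2 * n`!).-1).
Proof.
move=> m n mn.
have fle k : k`! <= (2 * k`!).-1.
  rewrite mul2n -addnn -ltnS prednK ?addn_gt0 ?fact_gt0 //.
  by rewrite -[X in X < _]addn0 ltn_add2l fact_gt0.
split; [exact: leq_trans (fact_gt0 n) (fle n) |
  exact: leq_trans mn (leq_trans (fact_geq n) (fle n)) |].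
move=> p /andP[p0 pm]; apply/eqP.
have P k : m <= k -> (2 * k`!).-1 = p.-1 %[mod p].
  move=> mk; apply/eqP; rewrite -(eqn_modDr 1) !addn1 !prednK ?muln_gt0 ?fact_gt0 //.
  have /dvdnP[c ->] : p %| 2 * k`!.
    by apply: dvdn_mull; rewrite dvdn_fact // p0 (leq_trans pm).
  by rewrite modnMl modnn.
by rewrite !P.
Qed.

(* omega = lim n!, and omega - 1 = lim (2 n! - 1) since lim (2 n!) is also omega;
   n! - 1 itself would not be positive at n = 1. *)
Definition omega : Zhat := zlim fact_stable.
Definition omega_pred : Zhat := zlim fact_pred_stable.

Lemma omega_cvg : (fun n => zhat n`!) @ \oo --> omega.
Proof. exact: (@zlim_cvg _ fact_stable). Qed.

(* The power s^nu of an element s of the profinite semigroup completion allS N *)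
Definition upow (N : semigroupType) (s : completion allS N) (nu : Zhat) :
    completion allS N :=
  cext (Zplus_pow s) nu.

Lemma upow_cont_hom (N : semigroupType) (T : finSemigroup)
    (phi : {multiplicative completion allS N -> T}) s nu :
  continuous (phi : _ -> discrete_topology T) ->
  phi (upow s nu) = ev (Zplus_pow (phi s)) nu.
Proof.
move=> phic; pose u x : discrete_topology T := phi (upow s x).
pose v x : discrete_topology T := ev (Zplus_pow (phi s)) x.
suff uv : u = v by exact: (congr1 (fun k => k nu) uv).
apply: eta_unique => [x| |m].
- by move=> B /phic; exact: cext_continuous.
- exact: ev_continuous.
rewrite /u /v /upow cext_eta ev_eta /= /Zplus_pow /spow.
by elim: (val m).-1 => [//|n IHn] /=; rewrite gmulfM IHn.
Qed.

Lemma ev_zlim (T : finSemigroup) (x : T) u (us : stable u) :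
  ev (Zplus_pow x) (zlim us) = spow x (u #|T|).
Proof.
have [u0 _ _] := us _ _ (leqnn #|T|).
by rewrite /ev /= enum_rankK card_ord /Zplus_pow posnK.
Qed.

(* x^omega is idempotent and x^(omega-1) is the inverse of x^omega x in the
   maximal subgroup with identity x^omega. *)
Lemma omega_pred_spec (T : finSemigroup) (x : T) :
  let e := ev (Zplus_pow x) omega in
  let y := ev (Zplus_pow x) omega_pred in
  [/\ e * e = e, e * y = y, y * e = y, y * (e * x) = e & e * x * y = e].
Proof.
rewrite /omega /omega_pred !ev_zlim /=; set N := (#|T|) `!.
have N0 : 0 < N by exact: fact_gt0.
have [i [p [/andP[_ iT] pT fP]]] := pow_period (Zplus_pow x).
have iN : i <= N by apply: leq_trans iT (fact_geq _).
have xP a b : N <= a -> N <= b -> a = b %[mod N] -> spow x a = spow x b.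
  move=> Na Nb ab; have a0 := leq_trans N0 Na; have b0 := leq_trans N0 Nb.
  rewrite -(posnK a0) -(posnK b0); apply: fP; [exact: leq_trans Na |
    exact: leq_trans Nb |].
  have pN : p %| N by exact: dvdn_fact.
  by rewrite -[LHS](modn_dvdm _ pN) ab modn_dvdm.
have M1 : N <= (2 * N).-1.
  rewrite mul2n -addnn -ltnS prednK ?addn_gt0 ?N0 //.
  by rewrite -[X in X < _]addn0 ltn_add2l.
have M0 : 0 < (2 * N).-1 by exact: leq_trans N0 M1.
have eX : spow x N * x = spow x N.+1 by rewrite -addn1 spowD.
rewrite eX -!spowD //; split; apply: xP; rewrite ?addSn ?addnS ?leq_addr ?leq_addl //.
- by rewrite modnDl modnn.
- by rewrite modnDl.
- by rewrite modnDr.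
- by rewrite leqW ?leq_addl.
- by rewrite -addSn prednK ?muln_gt0 // modnDr modnMl modnn.
- by rewrite leqW ?leq_addr.
- by rewrite -addnS prednK ?muln_gt0 // modnDl modnMl modnn.
Qed.

(* Omega V A is the free pro-V semigroup on A *)
Notation Omega V A := (completion V (word A)).
Notation pseudoword A := (Omega allS A).

Definition gen (A : finType) (a : A) : pseudoword A := eta allS (letter a).

(* The operation defined by the pseudoword w on the profinite semigroup
   Omega allS A: the image of w under the unique continuous homomorphism that
   maps the i-th letter to t i. *)
Definition interp (n : nat) (A : finType) (w : pseudoword 'I_n)
    (t : 'I_n -> pseudoword A) : pseudoword A :=
  cext (word_ext t) w.

Definition mulop : pseudoword 'I_2 := gen ord0 * gen ord_max.

(* x |-> x^nu *)
Definition powop (nu : Zhat) : pseudoword 'I_1 := upow (gen ord0) nu.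

(* A pseudoword over any finite alphabet is, up to a bijection of the alphabet,
   a pseudoword over 'I_n. *)
Record signature := Signature {
  sig_op :> forall n, set (pseudoword 'I_n);
  sig_mul : sig_op mulop }.

Inductive sig_sub (sigma : signature) (A : finType) : pseudoword A -> Prop :=
| Sig_gen a : sig_sub sigma (gen a)
| Sig_op n (w : pseudoword 'I_n) (t : 'I_n -> pseudoword A) :
    sigma n w -> (forall i, sig_sub sigma (t i)) -> sig_sub sigma (interp w t).

Inductive kappa_op : forall n, pseudoword 'I_n -> Prop :=
| Kappa_mul : kappa_op mulop
| Kappa_inv : kappa_op (powop omega_pred).

Definition kappa : signature := Signature Kappa_mul.

(* nu satisfies the requirement on nu_pi *)
Definition is_nu (pi : set nat) (nu : Zhat) : Prop :=
  (pi = set0 /\ nu = omega * zhat 1) \/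
  (pi <> set0 /\ exists2 p : nat -> nat, range p = pi &
     cluster ((fun n => zhat ((\prod_(i < n) p i) ^ n`!)%N) @ \oo) nu).

(* k(mu + 1) = nu - 1, where nu - 1 = nu + (omega - 1) *)
Definition kappa_exponent (nu mu : Zhat) : Prop :=
  exists2 k, 0 < k & spow (mu * zhat 1) k = nu * omega_pred.

Inductive kappa_pi_op (nu : Zhat) : forall n, pseudoword 'I_n -> Prop :=
| Kappa_pi_kappa n (w : pseudoword 'I_n) : kappa n w -> kappa_pi_op nu w
| Kappa_pi_pow mu : kappa_exponent nu mu -> ~ sig_sub kappa (powop mu) ->
    kappa_pi_op nu (powop mu).

Definition kappa_pi (nu : Zhat) : signature :=
  Signature (Kappa_pi_kappa nu Kappa_mul).

Definition onto_cont (A : finType) (S : finSemigroup)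
    (phi : {multiplicative pseudoword A -> S}) : Prop :=
  continuous (phi : _ -> discrete_topology S) /\ range phi = setT.

Definition lifts V (A : finType) (S : finSemigroup) (phi : pseudoword A -> S)
    (P : set S) (P' : set (pseudoword A)) : Prop :=
  phi @` P' = P /\ exists q : Omega V A, @pV V _ @` P' = [set q].

Definition idem_lifts V (A : finType) (S : finSemigroup)
    (phi : pseudoword A -> S) (P : set S) (P' : set (pseudoword A)) : Prop :=
  phi @` P' = P /\
  exists2 q : Omega V A, q * q = q & @pV V _ @` P' = [set q].

Definition pointlike V (S : finSemigroup) (P : set S) : Prop :=
  P !=set0 /\
  forall (A : finType) (phi : {multiplicative pseudoword A -> S}),
    onto_cont phi -> exists P', lifts V phi P P'.

Definition idem_pointlike V (S : finSemigroup) (P : set S) : Prop :=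
  P !=set0 /\
  forall (A : finType) (phi : {multiplicative pseudoword A -> S}),
    onto_cont phi -> exists P', idem_lifts V phi P P'.

Definition reducible_pointlike (sigma : signature) V : Prop :=
  forall (S : finSemigroup) (P : set S), pointlike V P ->
  forall (A : finType) (phi : {multiplicative pseudoword A -> S}),
    onto_cont phi ->
    exists2 P', P' `<=` @sig_sub sigma A & lifts V phi P P'.

Definition reducible_idem_pointlike (sigma : signature) V : Prop :=
  forall (S : finSemigroup) (P : set S), idem_pointlike V P ->
  forall (A : finType) (phi : {multiplicative pseudoword A -> S}),
    onto_cont phi ->
    exists2 P', P' `<=` @sig_sub sigma A & idem_lifts V phi P P'.

(* Main.v *)
(** Let V be the pseudovariety in question and call a set of elements of S liftable
    if it lifts to terms with a common image q in the free pro-V semigroup.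
    Liftable sets are closed under products and, if X generates a cyclic
    pi'-group of order n in the power semigroup of S, under the union of the
    powers of X: the operations x^mu with n(mu + 1) = nu - 1 make the projections
    q^j of the powers X^j equal to q^omega.

    Conversely, let M be a finite ordered monoid in which the cyclic pi'-groups
    have joins that are preserved by multiplication. Every map from an alphabet
    A to M is bounded, on all words, by a map that factors through a monoid in V.
    This is proved by induction on |M| and |A|. If the letters are units they
    generate a group G, and one takes the quotient of G by the subgroup generated
    by its pi'-elements. Otherwise one factors the words at the occurrences of a
    letter that is not a unit, and applies the induction hypothesis to the
    remaining letters and to the local divisor of M at that letter (Diekert and
    Kufleitner); the results are combined in a Rees matrix construction, which
    stays in V. When M is the monoid of liftable sets, this shows that every
    V-pointlike set is contained in a liftable one. For idempotent pointlike
    sets, iterated Schuetzenberger products moreover show that they are contained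
    in arbitrarily long powers X^n of a liftable set X. *)
From mathcomp Require Import all_boot all_fingroup zmodp cyclic pgroup zify.
From mathcomp Require Import all_classical.
From mathcomp Require Import topology.
Require Import Defs.

Set Implicit Arguments.
Unset Strict Implicit.
Unset Printing Implicit Defensive.

Local Open Scope classical_set_scope.
Local Open Scope group_scope.

(** * Powers in finite semigroups *)

Lemma spowSr (T : semigroupType) (x : T) n : 0 < n ->
  spow x n.+1 = spow x n * x.
Proof. by move=> n0; rewrite -addn1 spowD. Qed.

Lemma spowM (T : semigroupType) (x : T) m n : 0 < m -> 0 < n ->
  spow x (m * n) = spow (spow x m) n.
Proof.
move=> m0; elim: n => // n IHn _; have [->|n0] := posnP n; first by rewrite muln1.
by rewrite spowS // mulnS spowD ?muln_gt0 ?m0 // IHn.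
Qed.

Lemma spow_hom (S T : semigroupType) (f : {multiplicative S -> T}) x n :
  f (spow x n) = spow (f x) n.
Proof. by rewrite /spow; elim: n.-1 => //= k IH; rewrite gmulfM IH. Qed.

Lemma spow_idem (T : semigroupType) (x : T) n : 0 < n -> x * x = x ->
  spow x n = x.
Proof.
move=> + xx; elim: n => // n IHn _.
by have [->//|n0] := posnP n; rewrite spowS // IHn.
Qed.

(** Index and period of an element are at most [#|T|], so the factorial is above the index and
    divisible by the period. *)
Lemma spow_eqmod_fact (T : finSemigroup) (x : T) a b :
  (#|T|) `! <= a -> (#|T|) `! <= b -> a = b %[mod (#|T|) `!] -> spow x a = spow x b.
Proof.
set N := _ `! => Na Nb ab; have N0 : 0 < N by exact: fact_gt0.
have [i [p [/andP[_ iT] pT fP]]] := pow_period (Zplus_pow x).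
have iN : i <= N by apply: leq_trans iT (fact_geq _).
have a0 := leq_trans N0 Na; have b0 := leq_trans N0 Nb.
have := fP a b; rewrite /= /Zplus_pow !posnK //; apply.
- exact: leq_trans Na.
- exact: leq_trans Nb.
- have pN : p %| N by exact: dvdn_fact.
  by rewrite -[LHS](modn_dvdm _ pN) ab modn_dvdm.
Qed.

Lemma spow_eqmod (T : semigroupType) (x : T) n a b : 0 < n -> spow x n.+1 = x ->
  0 < a -> 0 < b -> a = b %[mod n] -> spow x a = spow x b.
Proof.
move=> n0 xn; have per c k : 0 < c -> spow x (c + k * n) = spow x c.
  move=> c0; elim: k => [|k IHk]; first by rewrite mul0n addn0.
  rewrite mulSn [(n + _)%N]addnC addnA -[LHS]/(spow x _) -IHk.
  move: (c + k * n)%N (ltn_addr (k * n) c0) => [//|d] _.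
  by have [->|d0] := posnP d; [rewrite add1n|
    rewrite addSnnS spowD // xn -spowSr].
wlog ab : a b / a <= b.
  by move=> W a0 b0 e; case/orP: (leq_total a b) => le; [|symmetry]; apply: W.
move=> a0 b0 /eqP; rewrite eq_sym eqn_mod_dvd // => /dvdnP[c cE].
by rewrite -(subnKC ab) cE per.
Qed.

(* Taking r divisible by the pi-part of D and congruent to 1 modulo its
   pi'-part, the map x |-> x^r kills the pi-part of the group generated by
   x^(omega+1) and fixes its pi'-part. *)
Lemma pi'_exponent (pi : nat_pred) n (N : nat) : 0 < N -> (negn pi).-nat n ->
  exists r d, [/\ N <= r, (negn pi).-nat d, n %| d,
    r = 1 %[mod d] & N %| r * d].
Proof.
move=> N0 nP; have n0 : 0 < n by case/andP: nP.
pose D := (n * N)%N; have D0 : 0 < D by rewrite muln_gt0 n0.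
pose r0 := chinese (D`_pi)%N (D`_(negn pi))%N 0 1.
have cop := coprime_partC pi D D.
exists (r0 + N * D)%N, (D`_(negn pi))%N; split.
- by apply: leq_trans (leq_addl _ _); rewrite leq_pmulr.
- exact: part_pnat.
- by rewrite -(part_pnat_id nP); apply: partn_dvd => //; exact: dvdn_mulr.
- rewrite -modnDmr (eqP (_ : _ %| N * D)); last first.
    by apply: dvdn_mull; exact: dvdn_part.
  by rewrite addn0 chinese_modr.
- apply: (@dvdn_trans D); first exact: dvdn_mull.
  rewrite -{1}(partnC pi D0) dvdn_pmul2r ?part_gt0 //.
  rewrite dvdn_addl; last by apply: dvdn_mull; exact: dvdn_part.
  by rewrite /dvdn chinese_modl // mod0n.
Qed.

(** * Closure properties of pseudovarieties defined by subgroups *)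

Lemma G_pi_injective (pi : set nat) (G H : finGroupType)
    (i : {multiplicative H -> G}) : injective i -> G_ pi G -> G_ pi H.
Proof.
move=> i_inj; rewrite /G_; apply: pnat_dvd.
pose f := Morphism (D := [set: H]%SET) (fun x y _ _ => @gmulfM _ _ i x y).
have f_inj : 'injm f by apply/injmP => x y _ _; exact: i_inj.
have /cardSg : (f @* [set: H]%G)%G \subset [set: G]%G by exact: finset.subsetT.
by rewrite /= card_injm // !cardsT.
Qed.

Lemma overline_group (pi : set nat) (G : finGroupType) :
  G_ pi G -> overline (G_ pi) (FinSemigroup (@mulgA G)).
Proof.
move=> piG H i i_inj.
exact: (@G_pi_injective pi G H (@mkhom H G i (@gmulfM _ _ i)) i_inj piG).
Qed.

Lemma overline_embed (H : finGroupType -> Prop) (S T : finSemigroup)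
    (g : {multiplicative S -> T}) :
  injective g -> overline H T -> overline H S.
Proof.
move=> g_inj VT G i i_inj.
exact: (VT G (g \o i) (inj_comp g_inj i_inj)).
Qed.

Section Rees.
Variables (B T : finSemigroup) (p : B -> T).

Definition rees_car : finType := (B + B * T * B)%type.

(** The [inr] elements form a Rees matrix semigroup over [T] with sandwich matrix [p (y * x)]; [B]
    acts by multiplication on its row and column indices. *)
Definition rees_mul (u v : rees_car) : rees_car :=
  match u, v with
  | inl s, inl t => inl (s * t)
  | inl s, inr (x, m, y) => inr (s * x, m, y)
  | inr (x, m, y), inl t => inr (x, m, y * t)
  | inr (x, m, y), inr (x', m', y') => inr (x, m * p (y * x') * m', y')
  end.

Lemma rees_mulA : associative rees_mul.
Proof.
by move=> [s|[[x m] y]] [s'|[[x' m'] y']] [s''|[[x'' m''] y'']];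
  rewrite /rees_mul ?mulgA.
Qed.

Definition rees : finSemigroup := FinSemigroup rees_mulA.

(** A subgroup with identity in [B] lies in [B], as the [inr] elements form an ideal. In any other,
    [x] and [y] are constant and [(x, m', y) |-> m' * p (y * x)] is injective: multiplication by the
    identity recovers the element. *)
Lemma overline_rees (H : finGroupType -> Prop) :
  overline H B -> overline H T -> overline H rees.
Proof.
move=> VB VT G i i_inj.
have iM g h : i (g * h) = rees_mul (i g) (i h) by rewrite gmulfM.
case i1 : (i 1) => [e|[[x m] y]].
  have il g : exists s, i g = inl s.
    case ig : (i g) => [s|[[x m] y]]; first by exists s.
    by have := iM g g^-1; rewrite mulgV i1 ig; case: (i g^-1) => [?|[[]]].
  pose j g := if i g is inl s then s else e.
  have jM : {morph j : g h / g * h}.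
    by move=> g h; rewrite /j iM; case: (il g) (il h) => [? ->] [? ->].
  apply: (VB G (mkhom jM)) => g h /=; rewrite /j => jgh; apply: i_inj; move: jgh.
  by case: (il g) (il h) => [? ->] [? ->] ->.
have ir g : exists m', i g = inr (x, m', y).
  have := iM 1 g; have := iM g 1; rewrite mul1g mulg1 i1.
  by case: (i g) => [//|[[x' m'] y']] [_ ->] [-> _]; exists m'.
pose j g := if i g is inr (_, m', _) then m' * p (y * x) else m.
have jM : {morph j : g h / g * h}.
  move=> g h; rewrite /j iM; case: (ir g) (ir h) => [m1 ->] [m2 ->] /=.
  by rewrite !mulgA.
apply: (VT G (mkhom jM)) => g h /= jgh; apply: i_inj.
rewrite -(mulg1 g) -(mulg1 h) !iM i1; move: jgh; rewrite /j.
by case: (ir g) (ir h) => [m1 ->] [m2 ->] /= ->.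
Qed.

End Rees.

Section Schutzenberger.
Variable T : finSemigroup.

Definition schutz_car : Type := (T * {set T * T})%type.

(* The second component of a product of factors collects the pairs of images of
   the two parts of each cut of the product. *)
Definition schutz_mul (u v : schutz_car) : schutz_car :=
  (u.1 * v.1,
   (u.1, v.1) |: ([set (u.1 * z.1, z.2) | z : T * T in v.2] :|:
                  [set (z.1, z.2 * v.1) | z : T * T in u.2])%SET).

Lemma mem_schutz_mul (u v : schutz_car) a b :
  reflect [\/ (a, b) = (u.1, v.1),
              exists2 c, (c, b) \in v.2 & a = u.1 * c |
              exists2 c, (a, c) \in u.2 & b = c * v.1]
    ((a, b) \in (schutz_mul u v).2).
Proof.
rewrite !inE; apply: (iffP or3P).
  case=> [/eqP|/imsetP[[c d] cd [-> ->]]|/imsetP[[c d] cd [-> ->]]].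
  - by constructor 1.
  - by constructor 2; exists c.
  - by constructor 3; exists d.
case=> [->|[c cd ->]|[c cd ->]]; first by constructor 1.
- by constructor 2; apply/imsetP; exists (c, b).
- by constructor 3; apply/imsetP; exists (a, c).
Qed.

Lemma schutz_mulA : associative schutz_mul.
Proof.
move=> u v w; have e1 : (schutz_mul u (schutz_mul v w)).1 =
  (schutz_mul (schutz_mul u v) w).1 by rewrite /= mulgA.
suff e2 : (schutz_mul u (schutz_mul v w)).2 = (schutz_mul (schutz_mul u v) w).2.
  by rewrite [LHS]surjective_pairing e1 e2 -surjective_pairing.
apply/finset.setP => -[a b]; apply/mem_schutz_mul/mem_schutz_mul.
  case=> [[-> ->]|[c /mem_schutz_mul[[-> ->]|[d vw ->]|[d vw ->]] ->]|[c uv ->]].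
  - constructor 3; exists v.1; last by [].
    by apply/mem_schutz_mul; constructor 1.
  - by constructor 1.
  - by constructor 2; exists d; rewrite //= mulgA.
  - constructor 3; exists d; last by [].
    by apply/mem_schutz_mul; constructor 2; exists c.
  - constructor 3; exists (c * v.1); last by rewrite /= mulgA.
    by apply/mem_schutz_mul; constructor 3; exists c.
case=> [[-> ->]|[c vw ->]|[c /mem_schutz_mul[[-> ->]|[d uv ->]|[d uv ->]] ->]].
- constructor 2; exists v.1; last by [].
  by apply/mem_schutz_mul; constructor 1.
- constructor 2; exists (v.1 * c); last by rewrite /= mulgA.
  by apply/mem_schutz_mul; constructor 2; exists c.
- by constructor 1.
- constructor 2; exists d; last by [].
  by apply/mem_schutz_mul; constructor 3; exists c.
- by constructor 3; exists d; rewrite //= mulgA.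
Qed.

Definition schutz : finSemigroup := @FinSemigroup (T * {set T * T})%type _ schutz_mulA.

(* The projection to T is injective on every subgroup: the cuts of
   e g g^-1 e include those inside g, which are hence also cuts of e. *)
Lemma overline_schutz (H : finGroupType -> Prop) :
  overline H T -> overline H schutz.
Proof.
move=> VT G i i_inj.
have iM g h : i (g * h) = schutz_mul (i g) (i h) by rewrite gmulfM.
pose j g := (i g).1; have jM : {morph j : g h / g * h} by move=> g h; rewrite /j iM.
have sub g : j g = j 1 -> (i g).2 \subset (i 1).2.
  move=> jg; apply/fintype.subsetP => -[a b] gab.
  have gb : (exists2 c, (a, c) \in (i (1 * g)).2 & b = c * j 1) \/
      (a, b) = (j g, j 1) \/ exists2 c, (c, b) \in (i 1).2 & a = j g * c.
    move: gab; rewrite -{1}(mulg1 g) iM => /mem_schutz_mul[[-> ->]|[c cb ->]|[c ac ->]].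
    - by right; left.
    - by right; right; exists c.
    - by left; exists c; rewrite ?mul1g.
  have sq x y : (x, y) = (j 1, j 1) \/ (exists2 c, (c, y) \in (i 1).2 & x = j 1 * c) \/
      (exists2 c, (x, c) \in (i 1).2 & y = c * j 1) -> (x, y) \in (i 1).2.
    move=> xy; rewrite -(mulg1 1) iM; apply/mem_schutz_mul.
    by case: xy => [->|[[c ? ->]|[c ? ->]]];
      [constructor 1|constructor 2; exists c|constructor 3; exists c].
  case: gb => [[c ac ->]|[->|[c cb ->]]].
  - have jgV : j g^-1 = j 1.
      by rewrite -[in LHS](mulg1 g^-1) jM -jg -jM mulVg jg.
    have := iM (1 * g) g^-1; rewrite {1}mul1g mulgV => ->.
    by apply/mem_schutz_mul; constructor 3; exists c; rewrite // -/(j _) jgV.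
  - by apply: sq; left; rewrite jg.
  - by apply: sq; right; left; exists c; rewrite ?jg.
have sup g : j g = j 1 -> (i 1).2 \subset (i g).2.
  move=> jg; apply/fintype.subsetP => -[a b].
  rewrite -(mulg1 1) iM => /mem_schutz_mul[|[c cb ->]|[c ac ->]].
  - by rewrite -(mulg1 g) iM => -[-> ->]; apply/mem_schutz_mul; constructor 1;
      rewrite -/(j g) jg.
  - by rewrite -(mulg1 g) iM; apply/mem_schutz_mul; constructor 2; exists c;
      rewrite // -/(j g) jg.
  - by rewrite -(mul1g g) iM; apply/mem_schutz_mul; constructor 3; exists c;
      rewrite // -/(j g) jg.
apply: (VT G (mkhom jM)) => g h /= jgh.
suff gh1 : g * h^-1 = 1 by rewrite -[LHS]mulg1 -(mulVg h) mulgA gh1 mul1g.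
have j1 : j (g * h^-1) = j 1 by rewrite jM jgh -jM mulgV.
apply: i_inj; rewrite [LHS]surjective_pairing -/(j _) j1.
by rewrite [RHS]surjective_pairing; congr pair;
  apply/eqP; rewrite finset.eqEsubset sub ?sup.
Qed.

End Schutzenberger.

(** * Saturated ordered monoids *)

Definition wprod (T : semigroupType) (A : Type) (e : T) (h : A -> T) (w : seq A) :
  T := foldr (fun a x => h a * x) e w.

Section Saturated.
Variable pi : set nat.
Notation pi' := (negn [pred p | p \in pi]).

(* In the intended example the elements of M are subsets of a finite semigroup
   and u is the union of the powers of g. *)
Record saturated (M : finSemigroup) (e : M) (le : rel M) : Prop := Saturated {
  sat_mul1l : left_id e *%g;
  sat_mul1r : right_id e *%g;
  sat_refl : reflexive le;
  sat_anti : antisymmetric le;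
  sat_trans : transitive le;
  sat_mul : forall x x' y y', le x x' -> le y y' -> le (x * y) (x' * y');
  sat_join : forall g n, pi'.-nat n -> spow g n.+1 = g -> exists u, forall x y z,
    (forall i, 0 < i -> le (x * spow g i * y) z) <-> le (x * u * y) z }.

(** * Local divisors *)

Section LocalDivisor.
Variables (M : finSemigroup) (a : M).

Definition ldiv_pred (x : M) :=
  [exists s : M, x == s * a] && [exists t : M, x == a * t].

Definition ldiv_car : finType := {x : M | ldiv_pred x}.

Lemma ldivl (x : ldiv_car) : exists s : M, val x = s * a.
Proof. by have /andP[/existsP[s /eqP ?] _] := valP x; exists s. Qed.

Lemma ldivr (x : ldiv_car) : exists t : M, val x = a * t.
Proof. by have /andP[_ /existsP[s /eqP ?]] := valP x; exists s. Qed.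

Lemma ldiv_mem (x s t : M) : x = s * a -> x = a * t -> ldiv_pred x.
Proof.
by move=> xs xt; apply/andP; split; apply/existsP;
  [exists s; rewrite {1}xs | exists t; rewrite {1}xt].
Qed.

Lemma ldiv_mul_subproof (x y : ldiv_car) :
  ldiv_pred (val x * sval (cid (ldivr y))).
Proof.
case: cid => t /= yt; have [s' xs'] := ldivl x; have [t' xt'] := ldivr x.
have [s ys] := ldivl y; apply: (@ldiv_mem _ (s' * s) (t' * t)).
  by rewrite xs' -mulgA -yt ys mulgA.
by rewrite xt' mulgA.
Qed.

Definition ldiv_mul (x y : ldiv_car) : ldiv_car := Sub _ (ldiv_mul_subproof x y).

(** The choice of [t] is immaterial: if [x = s a] and [y = a t], then [x t = s a t = s y]. *)
Lemma ldiv_mull x y (s : M) : val x = s * a -> val (ldiv_mul x y) = s * val y.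
Proof. by move=> xs /=; case: cid => t /= ->; rewrite [sval x]xs mulgA. Qed.

Lemma ldiv_mulr x y (t : M) : val y = a * t -> val (ldiv_mul x y) = val x * t.
Proof.
by move=> yt; have [s xs] := ldivl x; rewrite (ldiv_mull _ xs) yt mulgA -xs.
Qed.

Lemma ldiv_mulA : associative ldiv_mul.
Proof.
move=> x y z; apply: val_inj; have [s xs] := ldivl x; have [t zt] := ldivr z.
by rewrite (ldiv_mull _ xs) (ldiv_mulr _ zt) (ldiv_mulr _ zt) (ldiv_mull _ xs) mulgA.
Qed.

(* The local divisor of M at a: the set aM `&` Ma with product
   (s a) * (a t) = s a t, whose identity is a. *)
Definition ldiv : finSemigroup := FinSemigroup ldiv_mulA.

Lemma ldiv_spowl (g : ldiv) (s : M) i : val g = s * a -> 0 < i ->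
  val (spow g i) = spow s i * a.
Proof.
move=> gs; elim: i => // i IHi _; have [->|i0] := posnP i; first by [].
by rewrite spowS // (ldiv_mull _ gs) IHi // spowS // mulgA.
Qed.

Lemma ldiv_spowr (g : ldiv) (t : M) i : val g = a * t -> 0 < i ->
  val (spow g i) = a * spow t i.
Proof.
move=> gt; elim: i => // i IHi _; have [->|i0] := posnP i; first by [].
by rewrite spowSr // (ldiv_mulr _ gt) IHi // spowSr // mulgA.
Qed.

End LocalDivisor.

Lemma local_divisor (M : finSemigroup) (e : M) (le : rel M) (a : M) :
  saturated e le -> ~~ injectiveb (fun y : M => y * a) ->
  exists (M' : finSemigroup) (e' : M') (le' : rel M') (v : M' -> M),
    [/\ saturated e' le', #|M'| < #|M|,
       (forall x y, le' x y = le (v x) (v y)) /\ v e' = a,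
       forall m, exists x, v x = a * m * a &
       forall x y s, v x = s * a -> v (x * y) = s * v y].
Proof.
move=> satM a_ninj; have [mul1m mulm1] := (sat_mul1l satM, sat_mul1r satM).
have aP : ldiv_pred a a by apply: (@ldiv_mem _ _ _ e e).
pose e' : ldiv a := Sub a aP.
exists (ldiv a), e', (fun x y => le (val x) (val y)), val; split; last 1 first.
- by move=> x y s; exact: ldiv_mull.
- split.
  + by move=> x; apply: val_inj; rewrite (@ldiv_mull _ _ _ _ e) //= mul1m.
  + by move=> x; apply: val_inj; rewrite (@ldiv_mulr _ _ _ _ e) //= mulm1.
  + by move=> x; exact: (sat_refl satM).
  + by move=> x y /(sat_anti satM) /val_inj.
  + by move=> x y z; exact: (sat_trans satM).
  + move=> x x' y y' xx' yy'; have [s xs] := ldivl x; have [t yt] := ldivr y'.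
    rewrite (@sat_trans _ _ _ satM (val (x * y' : ldiv a))) //.
      by rewrite !(ldiv_mull _ xs); apply: (sat_mul satM) => //; exact: (sat_refl satM).
    by rewrite !(ldiv_mulr _ yt); apply: (sat_mul satM) => //; exact: (sat_refl satM).
  + move=> g n n_pi' gn; have [s gs] := ldivl g; have [t gt] := ldivr g.
    have n0 : 0 < n by case/andP: n_pi'.
    (* With [g = s a = a t], neither [s] nor [t] need generate a group in [M], but [s^r] and [t^r]
       generate pi'-groups, and [g^(r i) = g^i] as [r] is 1 modulo [n]. *)
    have [r [d [Nr d_pi' nd rd1 Nrd]]] := pi'_exponent (fact_gt0 #|M|) n_pi'.
    have r0 : 0 < r by apply: leq_trans Nr; exact: fact_gt0.
    have per x : spow (spow x r : M) d.+1 = spow x r.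
      rewrite -spowM // mulnS; apply: spow_eqmod_fact => //.
        by rewrite (leq_trans Nr) ?leq_addr.
      by rewrite -modnDmr (eqP Nrd) addn0.
    have ri i : 0 < i -> spow g (r * i) = spow g i.
      move=> i0; apply: (@spow_eqmod _ _ n) => //; first by rewrite muln_gt0 r0.
      by rewrite -modnMml -(modn_dvdm r nd) rd1 modn_dvdm // modnMml mul1n.
    have [u uP] := sat_join satM d_pi' (per t).
    have [u' u'P] := sat_join satM d_pi' (per s).
    have U x y z : (forall i, 0 < i -> le (x * val (spow g i) * y) z) <->
        le (x * (a * u) * y) z.
      rewrite mulgA -uP; split=> H i i0.
        by rewrite -spowM // -(mulgA x) -(ldiv_spowr gt) ?muln_gt0 ?r0 // ri // H.
      by rewrite -ri // (ldiv_spowr gt) ?muln_gt0 ?r0 // mulgA spowM // H.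
    have U' x y z : (forall i, 0 < i -> le (x * val (spow g i) * y) z) <->
        le (x * (u' * a) * y) z.
      rewrite !mulgA -(mulgA _ a y) -u'P; split=> H i i0.
        rewrite -spowM // !mulgA -(mulgA x) -(ldiv_spowl gs) ?muln_gt0 ?r0 // ri //.
        exact: H.
      by rewrite -ri // (ldiv_spowl gs) ?muln_gt0 ?r0 // mulgA spowM // -!mulgA
        mulgA H.
    (* Both elements are the join of the powers of [g] in [M]; being equal, they belong to the local
       divisor. *)
    have uu' : a * u = u' * a.
      apply: (sat_anti satM); have := U e e (u' * a); have := U' e e (a * u).
      rewrite !mul1m !mulm1 => H1 H2; apply/andP; split.
        by apply/H2; rewrite (U' e e) mul1m mulm1; exact: (sat_refl satM).
      by apply/H1; rewrite (U e e) mul1m mulm1; exact: (sat_refl satM).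
    pose w : ldiv a := Sub (a * u) (ldiv_mem uu' (erefl _)).
    exists w => x y z; have [sx xs] := ldivl x; have [ty yt] := ldivr y.
    have E (q : ldiv a) : val (x * q * y) = sx * val q * ty.
      by rewrite (ldiv_mulr _ yt) (ldiv_mull _ xs).
    by rewrite E -U; split=> H i i0; have := H i i0; rewrite E.
- rewrite card_sig; apply: (@leq_trans #|predC1 e|.+1); last first.
    by rewrite cardC1; case: #|M| (max_card (pred1 e)) => //; rewrite card1.
  rewrite ltnS; apply/subset_leq_card/fintype.subsetP => x.
  rewrite !inE => /andP[/existsP[s /eqP xs] _]; apply: contraNneq a_ninj => xe.
  (* The local divisor omits [e]: if [e = s a], right multiplication by [s] is injective, hence
     bijective on the finite set [M], with right multiplication by [a] as its inverse. *)
  have sa : cancel (fun y => y * s) (fun y : M => y * a).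
    by move=> y; rewrite -mulgA -xs xe mulm1.
  have [b _ ba] := injF_bij (can_inj sa).
  apply/injectiveP => y z; rewrite -(ba y) -(ba z) /=.
  by rewrite -!mulgA -xs xe !mulm1 => ->.
- by [].
- move=> m; have mP : ldiv_pred a (a * m * a).
    by apply: (@ldiv_mem _ _ _ (a * m) (m * a)); rewrite // mulgA.
  by exists (Sub (a * m * a) mP).
Qed.

End Saturated.

(** * Bounding words by maps through monoids in the pseudovariety *)

Section Key.
Variable pi : set nat.
Notation pp := [pred p | p \in pi].
Notation pi' := (negn pp).

(** If a prime outside [pi] divided the order of [G / K], Cauchy's theorem would give a coset of
    that order; the pi'-part of a representative [y] has the same image as [y], yet lies in [K]. *)
Lemma pi_residue_quotient (gT : finGroupType) (G : {group gT}) :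
  let K := <<[set x in G | p_elt pi' x]%SET>>%G in
  K <| G /\ pp.-nat #|G / K|.
Proof.
move=> K; have sKG : K \subset G.
  by rewrite gen_subG; apply/fintype.subsetP => x; rewrite inE => /andP[].
have nKG : G \subset 'N(K).
  apply: norms_gen; apply/fintype.subsetP => g gG; rewrite inE.
  apply/fintype.subsetP => _ /imsetP[x /[!inE] /andP[xG xp] ->].
  by rewrite groupJ // p_eltJ.
split; first by rewrite /normal sKG.
apply/pnatP => // p p_pr /(Cauchy p_pr)[x /morphimP[y yN yG ->] yp].
apply/negPn/negP => ppi.
have : coset K (y.`_pi') = 1.
  apply: coset_id; apply: mem_gen; rewrite inE groupX //=.
  exact: p_elt_constt.
rewrite morph_constt // constt_p_elt; last by rewrite /p_elt yp pnatE.
by move=> y1; move: p_pr; rewrite -yp y1 order1.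
Qed.

Lemma exists_maximal (T : finType) (le : rel T) (x0 : T) :
  reflexive le -> antisymmetric le -> ssrbool.transitive le ->
  exists2 m, le x0 m & forall z, le m z -> z = m.
Proof.
move=> refl anti tr.
case: (@arg_maxnP _ x0 (le x0) (fun m => #|[set z | le z m]%SET|) (refl x0)).
move=> m x0m mmax; exists m => // z mz; apply: anti; rewrite mz andbT.
have sub : [set t | le t m]%SET \subset [set t | le t z]%SET.
  by apply/fintype.subsetP => t; rewrite !inE => /tr; apply.
have /eqP E : [set t | le t m]%SET == [set t | le t z]%SET.
  by rewrite eqEcard sub; apply: mmax; exact: tr mz.
by have := refl z; move/finset.setP: E => /(_ z); rewrite !inE => ->.
Qed.

Definition V_bounded (M : finSemigroup) (e : M) (le : rel M) (A : finType)
    (h : A -> M) : Prop :=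
  exists (T : finSemigroup) (eT : T) (psi : A -> T) (F : T -> M),
    [/\ left_id eT *%g, right_id eT *%g, overline (G_ pi) T &
       forall w, le (wprod e h w) (F (wprod eT psi w))].

(* The letters act as permutations, hence generate a group G. With K the
   subgroup generated by the pi'-elements of G, the quotient G / K is a
   pi-group, and an element m that is maximal above the identity is an upper
   bound of K, since m g <= m for every pi'-element g. *)
Lemma V_bounded_units (M : finSemigroup) (e : M) (le : rel M) (A : finType)
    (h : A -> M) :
  saturated pi e le -> (forall a, injective (fun y => y * h a)) ->
  V_bounded e le h.
Proof.
move=> satM h_inj; have [mul1m mulm1] := (sat_mul1l satM, sat_mul1r satM).
have [refl anti tr] := And3 (sat_refl satM) (sat_anti satM) (sat_trans satM).
have le_mul := sat_mul satM.
(* These are the bijective right translations. Permutations compose from left to right, so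
   [s |-> s e] is multiplicative. *)
pose Gs := [set s : {perm M} | [forall y, s y == y * s e]]%SET.
have GsP (s : {perm M}) : reflect (forall y, s y = y * s e) (s \in Gs).
  rewrite inE; apply: (iffP fintype.forallP) => H y; first by apply/eqP.
  exact/eqP.
have GsM (s t : {perm M}) : s \in Gs -> t \in Gs -> (s * t) e = s e * t e.
  by move=> sG /GsP tG; rewrite permM tG.
have Gg : group_set Gs.
  apply/group_setP; split; first by apply/GsP => y; rewrite !perm1 mulm1.
  move=> s t sG tG; apply/GsP => y; rewrite GsM // permM.
  by move/GsP: tG => ->; move/GsP: sG => ->; rewrite mulgA.
pose G := Group Gg; pose K := <<[set x in G | p_elt pi' x]%SET>>%G.
have [nKG piGK] : K <| G /\ pp.-nat #|G / K| := pi_residue_quotient G.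
have [m em mmax] := exists_maximal e refl anti tr.
have absorb k : k \in K -> le (k e) m.
  pose Hs := [set k in G | le (m * k e) m]%SET.
  have Hg : group_set Hs.
    apply/group_setP; split; first by rewrite inE group1 perm1 mulm1 refl.
    move=> x y; rewrite inE => /andP[xG xm]; rewrite inE => /andP[yG ym].
    rewrite inE groupM //= GsM // mulgA; apply: (tr _ _ _ _ ym).
    by rewrite le_mul.
  have sKH : K \subset Group Hg.
    rewrite gen_subG; apply/fintype.subsetP => x; rewrite inE => /andP[xG xp].
    have powx i : 0 < i -> spow (x e) i = (x ^+ i) e.
      elim: i => // i IHi _; have [->|i0] := posnP i; first by rewrite expg1.
      by rewrite spowS // IHi // expgS GsM // (groupX (G := G)).
    have xx : spow (x e) #[x].+1 = x e.
      by rewrite powx // expgS expg_order mulg1.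
    have [u uP] := sat_join satM xp xx.
    have leu i : 0 < i -> le ((x ^+ i) e) u.
      move=> i0; rewrite -powx // -[spow _ _]mul1m -[_ * _]mulm1.
      by move: i i0; apply/uP; rewrite mul1m mulm1.
    (* The identity is a power of [x], so [e <= u] and [m <= m u]; maximality gives [m u = m], hence
       [m * x e <= m]. *)
    have eu : le e u by have := leu _ (order_gt0 x); rewrite expg_order perm1.
    have mu : m * u = m.
      by apply: mmax; rewrite -{1}(mulm1 m) le_mul.
    rewrite inE; apply/andP; split=> //.
    by rewrite -{2}mu le_mul // -[x]expg1 leu.
  move=> /(fintype.subsetP sKH); rewrite inE => /andP[_]; apply: tr.
  by rewrite -{1}(mul1m (k e)) le_mul.
pose rho a := perm (h_inj a).
have rhoG a : rho a \in G.
  by apply/GsP => y; rewrite !permE mul1m.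
pose P w := wprod 1 rho w.
have PG w : P w \in G.
  by elim: w => [|a w IHw]; [exact: group1 | exact: groupM (rhoG a) IHw].
have PE w : wprod e h w = P w e.
  elim: w => [|a w IHw] /=; first by rewrite perm1.
  by rewrite IHw GsM // ?PG ?permE ?mul1m //; exact: rhoG.
pose Q := (G / K)%G; pose sQ : finGroupType := subg_of Q.
pose T := FinSemigroup (@mulgA sQ).
pose psi a : T := subg Q (coset K (rho a)).
exists T, (1 : sQ), psi, (fun t : sQ => m * repr (val t) e).
split.
  by move=> x; exact: (@mul1g sQ).
  by move=> x; exact: (@mulg1 sQ).
  by apply: overline_group; rewrite /G_ card_sub.
have NG g : g \in G -> g \in 'N(K) by exact: (fintype.subsetP (normal_norm nKG)).
move=> w; have -> : wprod (1 : T) psi w = subg Q (coset K (P w)).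
  elim: w => [|a w IHw].
    by apply: val_inj; rewrite [P [::]]/= morph1 /= subgK ?group1.
  rewrite [LHS]/= IHw [P (a :: w)]/= -/(P w) coset_morphM ?NG ?rhoG //.
  by rewrite subgM ?mem_quotient ?rhoG ?PG.
have PN : P w \in 'N(K) by rewrite (fintype.subsetP (normal_norm nKG)).
rewrite PE /= subgK ?mem_quotient //; set r := repr _.
have : r \in K :* P w by rewrite -val_coset // mem_repr_coset.
case/rcosetP => k kK rE; have -> : P w = k^-1 * r by rewrite rE mulKg.
have kG : k^-1 \in G by rewrite groupV (fintype.subsetP (normal_sub nKG)).
rewrite GsM //; last first.
  rewrite rE; apply: (@groupM _ G); rewrite ?PG //.
  by rewrite (fintype.subsetP (normal_sub nKG)).
by rewrite le_mul // absorb // groupV.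
Qed.

(* A word without a is represented by its image in B; a word u a w1 a ... wk a v,
   with no a in u, v and the wi, by the images of u and v in B and by the image
   in T' of the word over the alphabet B formed by the images of the wi. *)
Lemma V_bounded_rees (M M' : finSemigroup) (e : M) (e' : M') (le : rel M)
    (le' : rel M') (v : M' -> M) (A : finType) (h : A -> M) (a : A)
    (hB := fun b : {b : A | b != a} => h (val b)) :
  saturated pi e le ->
  (forall x y, le' x y = le (v x) (v y)) -> v e' = h a ->
  (forall m, exists x, v x = h a * m * h a) ->
  (forall x y s, v x = s * h a -> v (x * y) = s * v y) ->
  V_bounded e le hB ->
  (forall (C : finType) (k : C -> M'), V_bounded e' le' k) ->
  V_bounded e le h.
Proof.
move=> satM le'E ve' vsurj vM [B [eB [psiB [FB [mul1B mulB1 VB FBP]]]]] IH.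
have [mul1m mulm1] := (sat_mul1l satM, sat_mul1r satM).
have [refl tr le_mul] := And3 (sat_refl satM) (sat_trans satM) (sat_mul satM).
(* A block with image [t] becomes an element of [M'] that [v] maps to [h a * FB t * h a]; the
   product of [M'] merges the copies of [h a] shared by adjacent blocks. *)
have [k kE] := @choice B M' (fun t x => v x = h a * FB t * h a)
  (fun t => vsurj (FB t)).
have [T' [eT' [psi' [F' [mul1T' mulT'1 VT' F'P]]]]] := IH B k.
pose eT : rees psi' := inl eB.
pose psi b : rees psi' :=
  if insub b is Some b' then inl (psiB b') else inr (eB, eT', eB).
pose F (t : rees psi') := match t with
  | inl t => FB t
  | inr (x, m, y) => FB x * v (F' m) * FB y
  end.
exists (rees psi'), eT, psi, F; split; last 2 first.
- exact: overline_rees.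
- have parse w : match wprod eT psi w with
    | inl t => exists w', wprod eB psiB w' = t /\ wprod e hB w' = wprod e h w
    | inr (x, m, y) => exists u0 w' u1, [/\ wprod eB psiB u0 = x,
        wprod eT' psi' w' = m, wprod eB psiB u1 = y &
        le (wprod e h w)
          (wprod e hB u0 * v (wprod e' k w') * wprod e hB u1)]
    end.
    elim: w => [|b w IHw]; first by exists [::].
    rewrite [wprod eT _ _]/= {1}/psi; case: insubP => [b' _ bE|].
      case: (wprod eT psi w) IHw => [t|[[x m] y]] /=; first move=> [w' [<- wE]].
        by exists (b' :: w') => /=; rewrite wE {1}/hB bE.
      move=> [u0 [w' [u1 [<- <- <- wle]]]]; exists (b' :: u0), w', u1; split=> //=.
      by rewrite {1}/hB bE -!mulgA le_mul // !mulgA.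
    rewrite negbK => /eqP ->.
    case: (wprod eT psi w) IHw => [t|[[x m] y]] /=; first move=> [w' [<- wE]].
      exists [::], [::], w'; split=> //=.
      by rewrite mul1m ve' wE refl.
    move=> [u0 [w' [u1 [<- <- <- wle]]]]; exists [::], (wprod eB psiB u0 :: w'), u1.
    split=> //=; first by rewrite mul1T' mul1B.
    rewrite mul1m (vM _ _ _ (kE _)).
    apply: (tr _ _ _ (le_mul _ _ _ _ (refl (h a)) wle)).
    by rewrite !mulgA !le_mul.
  move=> w; move: (parse w); case: (wprod eT psi w) => [t [w' [<- <-]]|[[x m] y]].
    exact: FBP.
  move=> [u0 [w' [u1 [<- <- <- wle]]]]; apply: (tr _ _ _ wle).
  by rewrite /= !le_mul ?FBP // -le'E.
- by case=> [s|[[x m] y]]; rewrite /mul /= mul1B.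
- by case=> [s|[[x m] y]]; rewrite /mul /= mulB1.
Qed.

(** The outer induction is on the size of [M], since passing to the local divisor may enlarge the
    alphabet; deleting the letter [a] keeps [M] and shrinks [A]. *)
Theorem V_bounded_saturated (M : finSemigroup) (e : M) (le : rel M) (A : finType)
    (h : A -> M) : saturated pi e le -> V_bounded e le h.
Proof.
have [n] := ubnP #|M|; elim: n => // n IHn in M e le A h *.
have [k] := ubnP #|A|; elim: k => // k IHk in A h *.
rewrite !ltnS => Ak Mn satM.
have [/fintype.forallP h_inj|/forallPn[a a_ninj]] :=
  boolP [forall a, injectiveb (fun y : M => y * h a)].
  by apply: V_bounded_units => // a; exact/injectiveP.
have [M' [e' [le' [v [satM' M'M [le'E ve'] vsurj vM]]]]] :=
  local_divisor satM a_ninj.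
apply: (V_bounded_rees satM le'E ve' vsurj vM).
  apply: IHk => //; rewrite card_sig; apply: leq_trans Ak.
  rewrite (cardD1 a A) ltnS; apply: subset_leq_card.
  by apply/fintype.subsetP => x; rewrite !inE andbT.
by move=> C c; apply: IHn => //; exact: leq_trans M'M Mn.
Qed.

End Key.

(** * Exponents in the profinite completion of the positive integers *)

Section Product.
Variables S T : finSemigroup.

Definition prod_mul (u v : S * T) : S * T := (u.1 * v.1, u.2 * v.2).

Lemma prod_mulA : associative prod_mul.
Proof. by move=> u v w; rewrite /prod_mul /= !mulgA. Qed.

Definition prod_sg : finSemigroup := @FinSemigroup (S * T)%type _ prod_mulA.

Lemma prod_fstM : {morph (fun u : prod_sg => u.1) : x y / x * y}.
Proof. by []. Qed.

Lemma prod_sndM : {morph (fun u : prod_sg => u.2) : x y / x * y}.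
Proof. by []. Qed.

Lemma ev_image2 (M : semigroupType) (f : {multiplicative M -> S})
    (g : {multiplicative M -> T}) x :
  exists m, ev f x = f m /\ ev g x = g m.
Proof.
have fgM : {morph (fun m => (f m, g m) : prod_sg) : u v / u * v}.
  by move=> u v; rewrite !gmulfM.
have [m mE] := ev_image (mkhom fgM) x; exists m.
rewrite (@ev_nat _ _ _ (mkhom fgM) f (mkhom prod_fstM)) //.
by rewrite (@ev_nat _ _ _ (mkhom fgM) g (mkhom prod_sndM)) // mE.
Qed.

End Product.

Lemma Zplus_hom_spow (T : finSemigroup) (f : {multiplicative Zplus -> T}) n :
  0 < n -> f (posn n) = spow (f (posn 1)) n.
Proof.
elim: n => // n IHn _; have [->//|n0] := posnP n.
by rewrite -addn1 posnD // gmulfM IHn // addn1 spowSr.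
Qed.

Lemma ev_spow (T : finSemigroup) (t : T) (x : Zhat) :
  exists2 c, 0 < c & ev (Zplus_pow t) x = spow t c.
Proof.
by have [c ->] := ev_image (Zplus_pow t) x; exists (val c); first exact: valP.
Qed.

Section Residue.
Variable m : nat.

Definition zp_sg : finSemigroup := @FinSemigroup 'I_m.+1 _ (@Zp_addA m.+1).

Definition zp_res (n : Zplus) : zp_sg := (inZp (val n) : 'I_m.+1).

Lemma zp_resM : {morph zp_res : x y / x * y}.
Proof.
by move=> x y; apply: val_inj; rewrite /mul /= modnDm.
Qed.

End Residue.

(* residue x m is the image of x in Z/m (m > 0) *)
Definition residue (x : Zhat) (m : nat) : nat :=
  val (ev (mkhom (@zp_resM m.-1)) x : 'I_m.-1.+1).

Lemma residueP (T : finSemigroup) (f : {multiplicative Zplus -> T}) x m :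
  0 < m -> exists2 c, 0 < c & ev f x = f (posn c) /\ residue x m = c %% m.
Proof.
move=> m0; have [c [fc gc]] := ev_image2 f (mkhom (@zp_resM m.-1)) x.
exists (val c); first exact: valP.
rewrite /residue fc gc /= prednK //; split=> //; congr (f _).
by apply: val_inj; rewrite posnK //; exact: valP.
Qed.

Lemma residue_dvd x m n : 0 < n -> m %| n -> residue x n = residue x m %[mod m].
Proof.
move=> n0 mn; have m0 : 0 < m by exact: dvdn_gt0 mn.
have [c c0 [fc ->]] := residueP (mkhom (@zp_resM n.-1)) x m0.
by rewrite {1}/residue fc /= /zp_res /= prednK // posnK // modn_dvdm // modn_mod.
Qed.

Lemma ev_zlim_eq (T : finSemigroup) (f : {multiplicative Zplus -> T}) u
    (us : stable u) n : #|T| <= n -> ev f (zlim us) = f (posn (u n)).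
Proof.
by move=> Tn; rewrite (stable_eq f us Tn) /ev /= enum_rankK card_ord.
Qed.

Lemma approx_cluster (u : nat -> nat) (nu : Zhat) (T : finSemigroup)
    (f : {multiplicative Zplus -> T}) j0 :
  cluster ((fun n => zhat (u n)) @ \oo) nu ->
  exists2 j, j0 <= j & ev f nu = f (posn (u j)).
Proof.
move=> nuc.
have A1 : ((fun n => zhat (u n)) @ \oo) [set y | exists2 j, j0 <= j & y = zhat (u j)].
  by exists j0 => // j /= ?; exists j.
have A2 : nbhs nu [set y | ev f y = ev f nu].
  exact: (@ev_continuous _ _ f nu [set ev f nu] (discrete_set1 _)).
have [y [[j jj ->] /= <-]] := nuc _ _ A1 A2.
by exists j => //; rewrite ev_eta.
Qed.

Lemma dvdn_prod_exp (p : nat -> nat) (d : nat) :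
  0 < d -> (forall q, q \in primes d -> exists i, p i = q) ->
  exists j0, forall j, j0 <= j -> d %| ((\prod_(i < j) p i) ^ j`!)%N.
Proof.
move=> d0 dP; have [i0 i0P] : exists i0, forall q, q \in primes d ->
    exists2 i, i < i0 & p i = q.
  elim: (primes d) dP => [|q s IHs] dP; first by exists 0.
  have [|i0 i0P] := IHs; first by move=> r rs; apply: dP; rewrite inE rs orbT.
  have [i iq] := dP q (mem_head q s); exists (maxn i0 i.+1) => r.
  rewrite inE => /orP[/eqP ->|/i0P[k ki kr]].
    by exists i; rewrite ?leq_maxr.
  by exists k; rewrite // (leq_trans ki) ?leq_maxl.
exists (maxn i0 d) => j; rewrite geq_max => /andP[i0j dj].
apply/dvdn_partP => // q; rewrite /= => qd; rewrite p_part.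
have [i ii0 iq] := i0P q qd.
apply: (@dvdn_trans (q ^ j`!)).
  apply: dvdn_exp2l; apply: leq_trans (fact_geq j); apply: leq_trans dj.
  by apply: ltnW; exact: ltn_logl.
apply: dvdn_exp2r; rewrite -iq.
by rewrite (bigD1 (Ordinal (leq_trans ii0 i0j))) //= dvdn_mulr.
Qed.

Lemma spow_period_mul (T : semigroupType) (t : T) N d a q : 0 < N ->
  spow t (N + d) = spow t N -> N <= a -> spow t (a + d * q) = spow t a.
Proof.
move=> N0 Nd Na; elim: q => [|q IHq]; first by rewrite muln0 addn0.
rewrite mulnS [(d + _)%N]addnC addnA -{}[RHS]IHq.
move: (leq_trans Na (leq_addr (d * q) a)); move: (a + d * q)%N => b.
rewrite leq_eqVlt => /orP[/eqP <-//|Nb].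
rewrite -(subnKC (ltnW Nb)) -addnA [(_ + d)%N]addnC addnA.
have [d0|d0] := posnP d; first by rewrite d0 addn0.
by rewrite !(spowD _ _ (_ : 0 < b - N)) ?subn_gt0 ?addn_gt0 ?N0 // Nd.
Qed.

(* The powers t^(N + i), for i modulo the period d, form a subgroup. *)
Lemma overline_period (pi : set nat) (T : finSemigroup) (t : T) :
  overline (G_ pi) T ->
  exists2 d, [pred p | p \in pi].-nat d &
    spow t ((#|T|) `! + d) = spow t ((#|T|) `!).
Proof.
set N := _ `! => VT; have N0 : 0 < N by exact: fact_gt0.
pose P d := (0 < d) && (spow t (N + d) == spow t N).
have exP : exists d, P d.
  exists N; rewrite /P N0; apply/eqP; apply: spow_eqmod_fact => //.
    exact: leq_addr.
  by rewrite modnDr modnn.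
have [d /andP[d0 /eqP dN] dmin] := ex_minnP exP; exists d => //.
have dK : d.-1.+1 = d by rewrite prednK.
pose G : finGroupType := 'I_d.-1.+1.
pose j (i : G) := spow t (N + i).
have jM : {morph j : x y / x * y}.
  move=> x y; rewrite /j -spowD ?addn_gt0 ?N0 //=.
  transitivity (spow t (N + (x + y))%N); last first.
    apply: spow_eqmod_fact; rewrite ?leq_addr //.
      by rewrite -addnA leq_addr.
    by rewrite addnACA -[(N + N + _)%N]addnA !modnDl.
  rewrite [in RHS](divn_eq (x + y) d) [(_ %/ d * d)%N]mulnC.
  rewrite [in RHS]addnCA [in RHS]addnC.
  rewrite (@spow_period_mul _ t N d) ?leq_addr //.
  by rewrite /mul /=; move: (nat_of_ord x + y)%N => s; rewrite dK.
have j_lt a b : a < b -> b < d -> spow t (N + a) <> spow t (N + b).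
  move=> ab bd E; suff /dmin : P (b - a)%N.
    by rewrite leqNgt (leq_ltn_trans _ bd) ?leq_subr.
  rewrite /P subn_gt0 ab; apply/eqP.
  (* Multiplying both powers by [t^(N (a + 1) - a)] and reducing exponents modulo [N] shows that
     [b - a] is a period, against the minimality of [d]. *)
  have aN : a < N * a.+1 by rewrite leq_pmull.
  have s0 : 0 < N * a.+1 - a by rewrite subn_gt0.
  have := congr1 (fun x => x * spow t (N * a.+1 - a)) E.
  rewrite -!spowD ?addn_gt0 ?N0 // -!addnA subnKC ?(ltnW aN) //.
  rewrite -(subnK (ltnW ab)) -[(_ + a + _)%N]addnA subnKC ?(ltnW aN) // addnK => {}E.
  transitivity (spow t (N + (b - a + N * a.+1))).
    apply: spow_eqmod_fact; rewrite ?leq_addr //.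
    by rewrite addnA -[in RHS]modnDmr modnMr addn0.
  rewrite -E; apply: spow_eqmod_fact; rewrite ?leq_addr //.
  by rewrite -modnDmr modnMr addn0.
have j_inj : injective j.
  move=> x y; rewrite /j => E; apply: val_inj; case: (ltngtP x y) => // xy.
    by case: (j_lt x y) => //; rewrite -[X in _ < X]dK.
  by case: (j_lt y x) => //; rewrite -[X in _ < X]dK.
have := VT G (mkhom jM) j_inj.
by rewrite /G_ card_ord dK.
Qed.

Lemma pred_2fact n : n`! <= (2 * n`!).-1.
Proof.
have := fact_gt0 n; rewrite mul2n -addnn.
by case: n`! => // m _; rewrite addSn /= leq_addl.
Qed.

(** * Solving [k (mu + 1) = nu - 1] for pi'-numbers [k] *)

Section Nu.
Variables (pi : set nat) (nu : Zhat).
Notation pp := [pred p | p \in pi].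
Hypothesis pi_prime : forall p, pi p -> prime p.
Hypothesis nuP : is_nu pi nu.

(* nu behaves as 0 on pi-groups and as 1 on pi'-groups. *)
Lemma nu_approx (T : finSemigroup) (f : {multiplicative Zplus -> T}) d k :
  pp.-nat d -> (negn pp).-nat k -> exists c,
  [/\ 0 < c, ev f nu = f (posn c), d %| c & c = 1 %[mod k]].
Proof.
move=> dP kP; have /andP[d0 dP'] := dP; have /andP[k0 kP'] := kP.
case: nuP => [[pi0 ->]|[_ [p prange nuc]]].
  have -> : d = 1%N.
    apply: (pnat_1 dP); apply/pnatP => // q _ _; rewrite !inE.
    by apply/negP; rewrite pi0 inE.
  have k_fact j : k <= j -> j`!.+1 = 1 %[mod k].
    move=> kj; have kd : k %| j`! by rewrite dvdn_fact // k0.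
    by rewrite -addn1 -modnDml (eqP kd).
  exists (maxn #|T| k)`!.+1; split=> //; last by apply: k_fact; exact: leq_maxr.
  rewrite evM ev_eta -[_`!.+1]addn1 posnD ?fact_gt0 // gmulfM.
  by congr (_ * _); apply: ev_zlim_eq; exact: leq_maxl.
have p_prime i : prime (p i) by apply: pi_prime; rewrite -prange; exists i.
have [|j0 j0P] := @dvdn_prod_exp p d d0.
  move=> q qd; have /set_mem : q \in pi by exact: (allP dP' q qd).
  by rewrite -prange => -[i _ <-]; exists i.
have [j] := approx_cluster f (maxn j0 (totient k)) nuc.
rewrite geq_max => /andP[j0j kj] fE; exists ((\prod_(i < j) p i) ^ j`!)%N.
have c0 : 0 < \prod_(i < j) p i by apply: prodn_gt0 => i; exact: prime_gt0.
split=> //; first by rewrite expn_gt0 c0.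
  exact: j0P.
(* The product is a pi-number, hence coprime to [k], so Euler's theorem applies to its power. *)
have /dvdnP[q ->] : totient k %| j`! by rewrite dvdn_fact // totient_gt0 k0.
rewrite mulnC expnM -modnXm Euler_exp_totient ?modnXm ?exp1n //.
have pn : pp.-nat (\prod_(i < j) p i)%N.
  apply: (big_ind (fun n => pp.-nat n)) => [//|x y px py|i _].
    by rewrite pnatM px.
  by rewrite pnatE //; apply/mem_set; rewrite -prange; exists i.
exact: pnat_coprime pn kP.
Qed.

(** The period of [t] is a pi-number, and [nu] acts as a multiple of it. *)
Lemma nu_omega_pred (T : finSemigroup) (t : T) : overline (G_ pi) T ->
  ev (Zplus_pow t) nu * ev (Zplus_pow t) omega_pred = ev (Zplus_pow t) omega_pred.
Proof.
move=> /(overline_period t)[d dP dN]; have N0 := fact_gt0 #|T|.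
have [|c [c0 -> /dvdnP[q cq] _]] := nu_approx (Zplus_pow t) dP (k := 1).
  by [].
have M0 := leq_trans N0 (pred_2fact #|T|).
rewrite ev_zlim /= /Zplus_pow posnK // -spowD // addnC cq [(q * d)%N]mulnC.
exact: spow_period_mul N0 dN (pred_2fact _).
Qed.

Section Division.
Variable k : nat.
Hypothesis kP : (negn [pred p | p \in pi]).-nat k.

Let k0 : 0 < k. Proof. by case/andP: kP. Qed.

Let kf0 n : 0 < k * n`!. Proof. by rewrite muln_gt0 k0 fact_gt0. Qed.

(** The quotient of [nu - 1] by [k], determined modulo [n!] because the residue is taken modulo
    [k n!]; the second summand stands for -1. The division is exact as [nu] is 1 modulo [k]. *)
Definition nu_quot (n : nat) : nat := (residue nu (k * n`!) + (k * n`!).-1) %/ k.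

Let residue_nu n : residue nu (k * n`!) = 1 %[mod k].
Proof.
have [|c [c0 fE _ c1]] := nu_approx
  (mkhom (@zp_resM (k * n`!).-1)) (d := 1) _ kP; first by [].
by rewrite /residue fE /= /zp_res /= prednK // posnK // modn_dvdm // dvdn_mulr.
Qed.

Lemma nu_quotE n : (k * nu_quot n).+1 = residue nu (k * n`!) + k * n`!.
Proof.
rewrite mulnC divnK; first by rewrite -addnS prednK.
rewrite /dvdn -[X in _ == X](mod0n k) -(eqn_modDr 1) add0n addn1 -addnS prednK //.
by rewrite -modnDmr -modnMml modnn mul0n mod0n addn0 residue_nu.
Qed.

(** The predecessor turns [(nu - 1) / k] into [mu]; the added multiple of [n!] makes the value
    exceed [n], as convergence requires. *)
Definition mu_seq n := (nu_quot n + n.+2 * n`!).-1.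

Let mu_seq_gt n : n < mu_seq n.
Proof.
rewrite -ltnS prednK ?addn_gt0 ?muln_gt0 ?fact_gt0 ?orbT //.
by rewrite (leq_trans _ (leq_addl _ _)) // leq_pmulr // fact_gt0.
Qed.

Lemma mu_seqE n c : residue nu (k * n`!) = c %[mod n`!] ->
  (k * (mu_seq n).+1).+1 = c %[mod n`!].
Proof.
move=> rc; rewrite prednK ?addn_gt0 ?muln_gt0 ?fact_gt0 ?orbT //.
rewrite mulnDr -addSn nu_quotE mulnA -modnDmr modnMl addn0 -modnDmr modnMl addn0.
exact: rc.
Qed.

Lemma mu_seq_stable : stable mu_seq.
Proof.
move=> m n mn; split; [exact: leq_ltn_trans (mu_seq_gt n) | |].
  exact: leq_trans mn (ltnW (mu_seq_gt n)).
move=> p /andP[p0 pm].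
have pm' : p %| m`! by rewrite dvdn_fact // p0.
suff E : mu_seq n = mu_seq m %[mod m`!].
  by rewrite -(modn_dvdm _ pm') E modn_dvdm.
have mn' : m`! %| n`! by rewrite -(ffact_fact (leq_subr m n)) subKn // dvdn_mull.
apply/eqP; rewrite -(eqn_modDr 1) !addn1 /mu_seq !prednK;
  rewrite ?addn_gt0 ?muln_gt0 ?fact_gt0 ?orbT //.
rewrite -modnDmr (eqP (dvdn_mull _ mn')) addn0.
rewrite -[X in _ == X]modnDmr modnMl addn0.
rewrite -(eqn_pmul2l k0) !muln_modr -(eqn_modDr 1) !addn1 !nu_quotE.
have kmn : k * m`! %| k * n`! by rewrite dvdn_pmul2l.
by rewrite modnDr -modnDmr (eqP kmn) addn0 (residue_dvd _ (kf0 n) kmn).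
Qed.

(** In each coordinate [T] both sides are powers of one element, with exponents at least [|T|!] and
    congruent to [nu - 1] modulo [|T|!]. *)
Lemma exists_mu : exists mu, spow (mu * zhat 1) k = nu * omega_pred.
Proof.
exists (zlim mu_seq_stable); apply: completion_eq => i.
set f := fi_hom i; set T := fi_sg i; pose t := f (posn 1).
have N0 := fact_gt0 #|T|.
have [c c0 [fc rc]] := residueP f nu (kf0 #|T|).
have -> : (nu * omega_pred : Zhat) i = spow t (c + (2 * (#|T|) `!).-1).
  rewrite spowD //; last exact: leq_trans N0 (pred_2fact _).
  rewrite -!Zplus_hom_spow //; last exact: leq_trans N0 (pred_2fact _).
  by rewrite -fc -coord_ev.
have -> : (spow (zlim mu_seq_stable * zhat 1) k : Zhat) i =
    spow t (k * (mu_seq #|T|).+1).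
  rewrite mulnC spowM // -[LHS]/(coord i _) spow_hom; congr (spow _ k).
  rewrite spowSr; last exact: leq_ltn_trans (mu_seq_gt #|T|).
  by rewrite -Zplus_hom_spow //; exact: leq_ltn_trans (mu_seq_gt #|T|).
apply: spow_eqmod_fact.
- apply: leq_trans (leq_pmull _ k0).
  rewrite (leq_trans _ (leqSpred _)) // (leq_trans _ (leq_addl _ _)) //.
  by rewrite leq_pmull.
- by rewrite (leq_trans (pred_2fact _)) // leq_addl.
apply/eqP; rewrite -(eqn_modDr 1) !addn1; apply/eqP.
rewrite (@mu_seqE _ c); last by rewrite rc modn_dvdm // dvdn_mull.
by rewrite -addnS prednK ?muln_gt0 // -modnDmr modnMl addn0.
Qed.

End Division.
End Nu.

(** * Implicit operations *)

Lemma word_ind (A : choiceType) (P : word A -> Prop) :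
  (forall a, P (letter a)) -> (forall a v, P v -> P (letter a * v)) ->
  forall u, P u.
Proof.
move=> P1 PS [a s]; elim: s a => [|b s IHs] a; first exact: P1.
exact: (PS a (b, s) (IHs b)).
Qed.

Lemma word_ext_cons (A : choiceType) (T : semigroupType) (t : A -> T) a u :
  word_ext t (letter a * u) = t a * word_ext t u.
Proof. exact: word_extM. Qed.

Lemma hom_word_ext (A : choiceType) (T T' : semigroupType) (t : A -> T)
    (f : {multiplicative T -> T'}) u : f (word_ext t u) = word_ext (f \o t) u.
Proof.
elim/word_ind: u => [//|a u IHu]; by rewrite !word_ext_cons gmulfM IHu.
Qed.

Lemma cext_cext (M N L : semigroupType) (h : {multiplicative N -> completion allS L})
    (g : {multiplicative M -> completion allS N})
    (k : {multiplicative M -> completion allS L}) x :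
  (forall m, cext h (g m) = k m) -> cext h (cext g x) = cext k x.
Proof.
move=> hgk; pose u := cext h \o cext g.
suff uk : u = cext k by exact: (congr1 (fun f => f x) uk).
apply: cext_unique => [y|m].
  by apply: continuous_comp; exact: cext_continuous.
by rewrite /u /= cext_eta hgk.
Qed.

Lemma interp_gen (A : finType) n (i : 'I_n) (t : 'I_n -> completion allS (word A)) :
  interp (gen i) t = t i.
Proof. by rewrite /interp cext_eta. Qed.

Lemma interp_interp (A : finType) m n (w : completion allS (word 'I_m))
    (s : 'I_m -> completion allS (word 'I_n))
    (t : 'I_n -> completion allS (word A)) :
  interp (interp w s) t = interp w (fun i => interp (s i) t).
Proof.
apply: cext_cext => u.
exact: (hom_word_ext s (mkhom (@cextM _ _ _ (word_ext t))) u).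
Qed.

Lemma interp_powop (A : finType) (mu : Zhat) (t : 'I_1 -> completion allS (word A)) :
  interp (powop mu) t = upow (t ord0) mu.
Proof.
apply: cext_cext => n; rewrite /= /Zplus_pow.
rewrite -[LHS]/(mkhom (@cextM _ _ _ (word_ext t)) _) spow_hom /=.
by rewrite cext_eta.
Qed.

Section SigSub.
Variable sigma : signature.

Lemma sig_sub_mul (A : finType) (x y : completion allS (word A)) :
  sig_sub sigma x -> sig_sub sigma y -> sig_sub sigma (x * y).
Proof.
move=> sx sy; pose t (i : 'I_2) := if i == ord0 then x else y.
have -> : x * y = interp mulop t.
  by rewrite /interp /mulop cextM -!/(interp _ _) !interp_gen.
apply: Sig_op; first exact: sig_mul.
by move=> i; rewrite /t; case: ifP.
Qed.

Lemma sig_sub_interp (A : finType) n (w : completion allS (word 'I_n))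
    (t : 'I_n -> completion allS (word A)) :
  sig_sub sigma w -> (forall i, sig_sub sigma (t i)) -> sig_sub sigma (interp w t).
Proof.
move=> sw st; elim: sw => [i|m v s sv _ IHs]; first by rewrite interp_gen.
by rewrite interp_interp; apply: Sig_op.
Qed.

Lemma sig_sub_upow (A : finType) (x : completion allS (word A)) mu :
  sig_sub sigma (powop mu) -> sig_sub sigma x -> sig_sub sigma (upow x mu).
Proof.
move=> smu sx; rewrite -(interp_powop mu (fun=> x)).
by apply: sig_sub_interp.
Qed.

Lemma sig_sub_powop mu : sigma 1%N (powop mu) -> sig_sub sigma (powop mu).
Proof.
move=> smu; rewrite [powop mu](_ : _ = interp (powop mu) (fun=> gen ord0)).
  by apply: Sig_op => // _; exact: Sig_gen.
by rewrite interp_powop.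
Qed.

End SigSub.

Lemma sig_sub_mono (sigma tau : signature) (A : finType) (x : completion allS (word A)) :
  (forall n, sigma n `<=` tau n) -> sig_sub sigma x -> sig_sub tau x.
Proof.
move=> st; elim=> [a|n w t sw _ IHt]; first exact: Sig_gen.
by apply: Sig_op => //; exact: st.
Qed.

(** * Power semigroups *)

Section PowerSet.
Variable S : finSemigroup.

Definition pset_mul (X Y : {set S}) : {set S} := 
  [set (x * y : S) | x : S in X, y : S in Y]%SET.

Lemma mem_pset_mul (X Y : {set S}) (z : S) :
  reflect (exists x y : S, [/\ x \in X, y \in Y & z = x * y]) (z \in pset_mul X Y).
Proof.
apply: (iffP imset2P) => [[x y xX yY ->]|[x [y [xX yY ->]]]]; first by exists x, y.
exact: (Imset2spec xX yY).
Qed.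

Lemma pset_mulA : associative pset_mul.
Proof.
move=> X Y Z; apply/finset.setP => t; apply/mem_pset_mul/mem_pset_mul.
  move=> [x [_ [xX /mem_pset_mul[y [z [yY zZ ->]]] ->]]].
  exists (x * y), z; split=> //; last by rewrite mulgA.
  by apply/mem_pset_mul; exists x, y.
move=> [_ [z [/mem_pset_mul[x [y [xX yY ->]]] zZ ->]]].
exists x, (y * z); split=> //; last by rewrite mulgA.
by apply/mem_pset_mul; exists y, z.
Qed.

Definition pset : finSemigroup := @FinSemigroup {set S} _ pset_mulA.

Lemma pset_mulS (X X' Y Y' : {set S}) : X \subset X' -> Y \subset Y' ->
  pset_mul X Y \subset pset_mul X' Y'.
Proof. by move=> XX YY; exact: imset2S. Qed.

Lemma mem_spow_idem (E : pset) x n : E * E = E -> 0 < n ->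
  x \in (E : {set S}) -> spow x n \in (E : {set S}).
Proof.
move=> EE + xE; elim: n => // n IHn _; have [->//|n0] := posnP n.
rewrite spowS // -EE; apply/mem_pset_mul; exists x, (spow x n); split=> //.
exact: IHn.
Qed.

(* Factoring z, then its right factor, and so on, produces infinitely many right
   factors in E; two of them coincide. *)
Lemma idem_set_factor (E : pset) z : E * E = E -> z \in (E : {set S}) ->
  exists a f b, [/\ a \in (E : {set S}), f \in (E : {set S}),
    b \in (E : {set S}), f * f = f & z = a * f * b].
Proof.
move=> EE zE.
have fact x : exists y, x \in (E : {set S}) ->
    y \in (E : {set S}) /\ exists2 p, p \in (E : {set S}) & x = p * y.
  have [xE|] := boolP (x \in (E : {set S})); last by exists x.
  move: (xE); rewrite -{1}EE => /mem_pset_mul[p [y [pE yE xpy]]].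
  by exists y => _; split=> //; exists p.
have [s sP] := choice fact.
have itE x k : x \in (E : {set S}) -> iter k s x \in (E : {set S}).
  by move=> xE; elim: k => //= k /sP[].
have it x k : x \in (E : {set S}) ->
    exists2 p, p \in (E : {set S}) & x = p * iter k.+1 s x.
  move=> xE; elim: k => [|k [p pE IHk]]; first by have [_] := sP _ xE.
  have [_ [p' p'E e]] := sP _ (itE x k.+1 xE).
  exists (p * p'); last by rewrite -mulgA [iter _ _ _]/= -e.
  by rewrite -EE; apply/mem_pset_mul; exists p, p'.
have [i [k e]] : exists i k, iter i.+1 s z = iter k.+1 s (iter i.+1 s z).
  pose u (k : 'I_#|S|.+1) := iter k s z.
  have /injectivePn[k0 [l0 nkl ukl]] : ~~ injectiveb u.
    apply/negP => /injectiveP/leq_card; by rewrite card_ord ltnn.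
  wlog lt_kl : k0 l0 nkl ukl / k0 < l0.
    move=> W; move: (nkl); rewrite -val_eqE neq_ltn => /orP[/W|/W]; first exact.
    by apply; rewrite 1?eq_sym.
  exists k0, (l0 - k0).-1; rewrite prednK ?subn_gt0 // -iterD addnS subnK 1?ltnW //.
  by rewrite !iterS -[iter k0 s z]/(u k0) ukl.
have [a aE za] := it z i zE; set b := iter i.+1 s z in e za.
have bE : b \in (E : {set S}) by exact: itE.
(* Here [b = g b], so [b = g^n b] for all [n > 0], and an idempotent power of [g] serves as [f]. *)
have [g gE] := it b k bE; rewrite -e => bg.
have N0 := fact_gt0 #|S|.
have gb n : 0 < n -> b = spow g n * b.
  elim: n => // n IHn _; have [->//|n0] := posnP n.
  by rewrite spowSr // -mulgA -bg -IHn.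
exists a, (spow g (#|S|) `!), b; split=> //; first exact: mem_spow_idem.
  rewrite -spowD //; apply: spow_eqmod_fact; rewrite ?leq_addr //.
  by rewrite modnDr modnn.
by rewrite -mulgA -gb.
Qed.

End PowerSet.

(** * Liftable sets *)

(* The powers x^(mu + 1), with mu an exponent of sigma, provide n-th roots of
   x^(omega-1) in the pseudovariety defined by pi, for each pi'-number n. *)
Definition has_roots (pi : set nat) (sigma : signature) : Prop :=
  forall n, (negn [pred p | p \in pi]).-nat n ->
  exists2 mu, sig_sub sigma (powop mu) &
  forall (T : finSemigroup) (t : T), overline (G_ pi) T ->
    spow (ev (Zplus_pow t) mu * t) n = ev (Zplus_pow t) omega_pred.

Section Good.
Variables (pi : set nat) (sigma : signature) (A : finType) (S : finSemigroup).
Notation V := (overline (G_ pi)).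
Notation pi' := (negn [pred p | p \in pi]).
Notation F := (completion allS (word A)).
Variable phi : {multiplicative F -> S}.
Hypothesis phi_cont : continuous (phi : _ -> discrete_topology S).

(* The common projection to the free pro-V semigroup is given by the family r of
   its coordinates, without the compatibility conditions, which hold as soon as
   some element is lifted. *)
Definition lifted (r : forall i : findex V (word A), fi_sg i) (x : S) : Prop :=
  exists w : F, [/\ sig_sub sigma w, phi w = x & forall i, coord i (@pV V _ w) = r i].

Definition good (X : {set S}) : Prop :=
  (exists x, x \in X) /\ exists r, forall x, x \in X -> lifted r x.

Lemma lifted_mul r r' x y : lifted r x -> lifted r' y ->
  lifted (fun i => r i * r' i) (x * y).
Proof.
move=> [w [sw <- wr]] [w' [sw' <- wr']]; exists (w * w'); split.
- exact: sig_sub_mul.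
- by rewrite gmulfM.
- by move=> i; rewrite pVM coordM wr wr'.
Qed.

Lemma lifted_spow r x n : 0 < n -> lifted r x ->
  lifted (fun i => spow (r i) n) (spow x n).
Proof.
move=> + rx; elim: n => // n IHn _; have [->//|n0] := posnP n.
rewrite spowS //; have [w [sw pw wr]] := lifted_mul rx (IHn n0).
by exists w; split=> // i; rewrite wr spowS.
Qed.

Lemma lifted_pset_spow r (X : {set S}) n x : 0 < n ->
  (forall x, x \in X -> lifted r x) -> x \in (spow (X : pset S) n : {set S}) ->
  lifted (fun i => spow (r i) n) x.
Proof.
move=> + rX; elim: n x => // n IHn x _; have [->|n0] := posnP n; first exact: rX.
rewrite spowS // => /mem_pset_mul[y [z [yX zX ->]]].
have [w [sw pw wr]] := lifted_mul (rX y yX) (IHn z n0 zX).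
by exists w; split=> // i; rewrite wr spowS.
Qed.

Lemma lifted_upow nu r x : sig_sub sigma (powop nu) -> lifted r x ->
  lifted (fun i => ev (Zplus_pow (r i)) nu) (ev (Zplus_pow x) nu).
Proof.
move=> snu [w [sw <- wr]]; exists (upow w nu); split.
- exact: sig_sub_upow.
- exact: upow_cont_hom.
- move=> i; rewrite -wr -[LHS]/(coord (forget_mem i) (upow w nu)).
  exact: (@upow_cont_hom _ (fi_sg (forget_mem i)) (coord (forget_mem i)) w nu
    (@coord_continuous _ _ (forget_mem i))).
Qed.

Lemma good_mul (X Y : pset S) : good X -> good Y -> good (X * Y).
Proof.
move=> [[x xX] [r rX]] [[y yY] [r' rY]]; split.
  by exists (x * y); apply/mem_pset_mul; exists x, y.
exists (fun i => r i * r' i) => _ /mem_pset_mul[x' [y' [x'X y'Y ->]]].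
exact: lifted_mul (rX _ x'X) (rY _ y'Y).
Qed.

Lemma good_spow (X : pset S) n : 0 < n -> good X -> good (spow X n).
Proof.
move=> + gX; elim: n => // n IHn _; have [->//|n0] := posnP n.
by rewrite spowS //; apply: good_mul => //; exact: IHn.
Qed.

Lemma good_gen a : good [set phi (gen a)]%SET.
Proof.
split; first by exists (phi (gen a)); rewrite inE.
exists (fun i => coord i (@pV V _ (gen a))) => x; rewrite inE => /eqP ->.
by exists (gen a); split=> //; exact: Sig_gen.
Qed.

Hypothesis sigma_inv : sig_sub sigma (powop omega_pred).
Hypothesis sigma_root : has_roots pi sigma.

(* An element of X^j is y a f b with y in X^j, a, f, b in X^n and f idempotent.
   If q is the common projection of the elements of X', then y a f f f b is
   lifted with projection q^j q^n (q^n)^(2(omega-1)) (q^n)^((mu+1)j) q^n, where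
   q^(n(mu+1)) = q^(omega-1), that is, with projection q^omega. *)
Lemma good_powers (X : pset S) n : good X -> pi'.-nat n -> spow X n.+1 = X ->
  exists2 r : forall i : findex V (word A), fi_sg i, forall i, r i * r i = r i &
  forall j x, 0 < j -> x \in (spow X j : {set S}) -> lifted r x.
Proof.
move=> [_ [r rX]] n_pi' Xn; have n0 : 0 < n by case/andP: n_pi'.
exists (fun i => ev (Zplus_pow (r i)) omega) => [i|j x j0].
  by case: (omega_pred_spec (r i)).
set E := spow X n; have EE : E * E = E.
  rewrite /E -spowD //; apply: (spow_eqmod n0) => //; rewrite ?addn_gt0 ?n0 //.
  by rewrite modnDl modnn.
have -> : spow X j = spow X j * E.
  rewrite /E -spowD //; apply: (spow_eqmod n0) => //; rewrite ?addn_gt0 ?j0 //.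
  by rewrite modnDr.
case/mem_pset_mul=> y [z [yX zE ->]].
have [a [f [b [aE fE bE ff ->]]]] := idem_set_factor EE zE.
have [mu smu muE] := sigma_root n_pi'.
have evf nu : ev (Zplus_pow f) nu = f.
  by have [c c0 ->] := ev_spow f nu; exact: spow_idem.
have liftE := lifted_pset_spow n0 rX.
have wf := liftE _ fE.
have wfi := lifted_upow sigma_inv wf; rewrite evf in wfi.
have wfm := lifted_spow j0 (lifted_mul (lifted_upow smu wf) wf).
rewrite evf ff spow_idem // in wfm.
have := lifted_mul (lifted_pset_spow j0 rX yX) (lifted_mul (lifted_mul
  (lifted_mul (liftE _ aE) (lifted_mul wfi wfi)) wfm) (liftE _ bE)).
rewrite ff -[a * f * f]mulgA ff => -[w [sw pw wr]]; exists w; split=> // i.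
rewrite {}wr; set t := r i; have VT : V (fi_sg i) := fi_mem i.
set N := (#|fi_sg i|) `!; have N0 : 0 < N by exact: fact_gt0.
set N' := (2 * N).-1; have N'0 : 0 < N' by rewrite /N' mul2n; case: (N) N0.
(* One integer [m] stands for [mu] at both [t] and [t^n], so [t^(n (m + 1))] can be read either
   way. *)
have [m [mt ms]] := ev_image2 (Zplus_pow t) (Zplus_pow (spow t n)) mu.
have m0 : 0 < val m by exact: valP.
have root : ev (Zplus_pow (spow t n)) mu * spow t n = spow t N'.
  rewrite ms /= /Zplus_pow -spowSr // -spowM // mulnC spowM //.
  by have := muE (fi_sg i) t VT; rewrite mt /= /Zplus_pow -spowSr // => ->;
    rewrite ev_zlim.
rewrite root !ev_zlim -/N -/N' -!spowM // -!spowD ?addn_gt0 ?muln_gt0 ?n0 ?N'0 ?j0 //.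
(* [N'] stands for omega - 1, and [N' + 1 = 2 N] makes the total exponent a multiple of [N]. *)
have -> : (j + (n + (n * N' + n * N') + N' * j + n) = (2 * (j + 2 * n)) * N)%N.
  by have : N'.+1 = (2 * N)%N by [rewrite prednK ?muln_gt0]; nia.
by apply: spow_eqmod_fact => //; [nia | rewrite modnMl modnn].
Qed.

End Good.

(** * Separation *)

Section AdjoinOne.
Variable S : finSemigroup.

Definition opt_mul (x y : option S) : option S :=
  match x, y with
  | Some a, Some b => Some (a * b)
  | Some a, None => Some a
  | None, _ => y
  end.

Lemma opt_mulA : associative opt_mul.
Proof. by move=> [a|] [b|] [c|]; rewrite /= ?mulgA. Qed.

Definition opt_sg : finSemigroup := @FinSemigroup (option S) _ opt_mulA.

Lemma pset_opt1l (Y : {set opt_sg}) : pset_mul [set None : opt_sg]%SET Y = Y.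
Proof.
apply/finset.setP => y; apply/mem_pset_mul/idP => [[_ [z [/[!inE]/eqP -> zY ->]]]//|yY].
by exists None, y; rewrite inE.
Qed.

Lemma pset_opt1r (Y : {set opt_sg}) : pset_mul Y [set None : opt_sg]%SET = Y.
Proof.
apply/finset.setP => y; apply/mem_pset_mul/idP => [[z [_ [zY /[!inE]/eqP -> ->]]]|yY].
  by case: z zY.
by exists y, None; rewrite inE; split=> //; case: y {yY}.
Qed.

Definition some_set (X : {set S}) : {set opt_sg} := [set Some x | x in X]%SET.

Lemma mem_some_set X x : ((Some x : opt_sg) \in some_set X) = (x \in X).
Proof. by apply: mem_imset => ? ? []. Qed.

Lemma none_some_set X : ((None : opt_sg) \in some_set X) = false.
Proof. by apply/negP => /imsetP[]. Qed.

Lemma some_setM : {morph (some_set : pset S -> pset opt_sg) : X Y / X * Y}.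
Proof.
move=> X Y; apply/finset.setP => -[z|].
  rewrite mem_some_set; apply/mem_pset_mul/mem_pset_mul.
    by move=> [x [y [xX yY ->]]]; exists (Some x), (Some y); rewrite !mem_some_set.
  move=> [[x|] [[y|] []]]; rewrite ?none_some_set // !mem_some_set => xX yY [->].
  by exists x, y.
rewrite none_some_set; apply/esym/negP => /mem_pset_mul[[x|] [[y|] []]] //.
by rewrite none_some_set.
Qed.

End AdjoinOne.

Section Separation.
Variables (pi : set nat) (sigma : signature) (A : finType) (S : finSemigroup).
Notation V := (overline (G_ pi)).
Notation pi' := (negn [pred p | p \in pi]).
Notation F := (completion allS (word A)).
Variable phi : {multiplicative F -> S}.
Hypothesis phi_cont : continuous (phi : _ -> discrete_topology S).
Hypothesis sigma_inv : sig_sub sigma (powop omega_pred).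
Hypothesis sigma_root : has_roots pi sigma.
Notation good := (@good pi sigma A S phi).

Definition good1 (Y : {set opt_sg S}) : bool :=
  `[< Y = [set None]%SET \/ exists2 X, good X & Y = some_set X >].

Lemma good1M (Y Z : {set opt_sg S}) : good1 Y -> good1 Z -> good1 (pset_mul Y Z).
Proof.
move=> /asboolP[->|[X gX ->]]; first by rewrite pset_opt1l.
move=> /asboolP[->|[X' gX' ->]]; apply/asboolP; right.
  by exists X; rewrite ?pset_opt1r.
by exists (pset_mul X X'); [exact: good_mul | rewrite some_setM].
Qed.

(* The good sets are encoded as sets of elements of S with an identity None
   adjoined, and the singleton of None is the identity of the resulting monoid. *)
Definition gmon_car : finType := {Y : {set opt_sg S} | good1 Y}.

Definition gmon_mul (Y Z : gmon_car) : gmon_car := Sub _ (good1M (valP Y) (valP Z)).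

Lemma gmon_mulA : associative gmon_mul.
Proof. by move=> X Y Z; apply: val_inj; exact: pset_mulA. Qed.

Definition gmon : finSemigroup := FinSemigroup gmon_mulA.

Lemma good1_none : good1 [set None]%SET. Proof. by apply/asboolP; left. Qed.

Definition gmon1 : gmon := Sub _ good1_none.

Definition gmon_le : rel gmon := fun Y Z => (val Y \subset val Z).

Lemma gmon_spow (Y : gmon) n : val (spow Y n) = spow (val Y : pset (opt_sg S)) n.
Proof. by rewrite /spow; elim: n.-1 => //= k ->. Qed.

(** The join is the union of the powers, liftable by [good_powers]; unions commute with products of
    sets. *)
Lemma gmon_saturated : saturated pi gmon1 gmon_le.
Proof.
split.
- by move=> Y; apply: val_inj; exact: pset_opt1l.
- by move=> Y; apply: val_inj; exact: pset_opt1r.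
- by move=> Y; rewrite /gmon_le.
- move=> Y Z; rewrite /gmon_le => /andP[YZ ZY]; apply/val_inj/eqP.
  by rewrite finset.eqEsubset YZ.
- by move=> Y X Z; exact: fintype.subset_trans.
- by move=> X X' Y Y'; exact: pset_mulS.
move=> g n n_pi' gn; have n0 : 0 < n by case/andP: n_pi'.
pose U := (\bigcup_(i < n) val (spow g i.+1))%SET.
have UP y : reflect (exists2 i, 0 < i & y \in val (spow g i)) (y \in U).
  apply: (iffP finset.bigcupP) => [[i _ yi]|[i i0 yi]]; first by exists i.+1.
  exists (Ordinal (ltn_pmod i.-1 n0)) => //.
  have <- // : spow g i = spow g (i.-1 %% n).+1.
  apply: (spow_eqmod n0) => //.
  by rewrite -{1}(prednK i0) -addn1 -modnDml addn1.
have gU : good1 U.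
  have /asboolP[g1|[X gX gE]] := valP g; apply/asboolP.
    left; apply/finset.setP => y; apply/UP/idP.
      move=> [i i0]; rewrite gmon_spow g1 spow_idem //; exact: pset_opt1l.
    by move=> y1; exists 1%N => //; rewrite g1.
  have powX i : val (spow g i) = some_set (spow (X : pset S) i).
    by rewrite gmon_spow gE -(spow_hom (mkhom (@some_setM S))).
  right; exists (\bigcup_(i < n) (spow (X : pset S) i.+1 : {set S}))%SET; last first.
    rewrite /U; apply/finset.setP => y; apply/finset.bigcupP/imsetP.
      move=> [i _]; rewrite powX => /imsetP[x xi ->]; exists x => //.
      by apply/finset.bigcupP; exists i.
    move=> [x /finset.bigcupP[i _ xi] ->]; exists i => //.
    by rewrite powX mem_some_set.
  have Xn : spow (X : pset S) n.+1 = X.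
    have := congr1 val gn; rewrite powX gE => /finset.setP XX.
    by apply/finset.setP => x; have := XX (Some x); rewrite !mem_some_set.
  have [r _ rP] := good_powers phi_cont sigma_inv sigma_root gX n_pi' Xn.
  split; last by exists r => x /finset.bigcupP[i _]; exact: rP.
  have [[x xX] _] := gX; exists x; apply/finset.bigcupP.
  by exists (Ordinal n0).
exists (Sub U gU : gmon) => x y z; split=> [H|/fintype.subsetP H i i0].
  apply/fintype.subsetP => _ /mem_pset_mul[_ [c [/mem_pset_mul[a [b [ax bU ->]]] cy ->]]].
  have /UP[i i0 bi] := bU; apply: (fintype.subsetP (H i i0)).
  apply/mem_pset_mul; exists (a * b), c; split=> //.
  by apply/mem_pset_mul; exists a, b.
apply/fintype.subsetP => _ /mem_pset_mul[_ [c [/mem_pset_mul[a [b [ax bi ->]]] cy ->]]].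
apply: H; apply/mem_pset_mul; exists (a * b), c; split=> //.
apply/mem_pset_mul; exists a, b; split=> //.
by apply/UP; exists i.
Qed.

Lemma wprod_word_ext (T : semigroupType) (e : T) (h : A -> T) a s :
  right_id e *%g -> wprod e h (a :: s) = word_ext h (a, s).
Proof.
move=> e1; elim: s a => [|b s IHs] a; first by rewrite /= e1.
rewrite -[(a, b :: s)]/(letter a * (b, s)) word_ext_cons -IHs //.
Qed.

Theorem separation : exists (T : finSemigroup) (psi : {multiplicative word A -> T}),
  V T /\ forall t, (exists u, psi u = t) -> exists2 X : {set S}, good X &
    forall u, psi u = t -> phi (eta allS u) \in X.
Proof.
have hP a : good1 (some_set [set phi (gen a)]%SET).
  by apply/asboolP; right; exists [set phi (gen a)]%SET => //; exact: good_gen.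
pose h a : gmon := Sub _ (hP a).
have [T [eT [psi [B [_ eT1 VT BP]]]]] := V_bounded_saturated h gmon_saturated.
exists T, (mkhom (word_extM psi)); split=> // t [u0 u0t].
have inB u : word_ext psi u = t -> (Some (phi (eta allS u)) : opt_sg S) \in val (B t).
  case: u => a s ut; have := BP (a :: s); rewrite !wprod_word_ext //; last first.
    by move=> Y; apply: val_inj; exact: pset_opt1r.
  rewrite ut => /fintype.subsetP; apply.
  elim/word_ind: (a, s) {ut} => [b|b v IHv].
    by rewrite mem_some_set inE.
  rewrite word_ext_cons; apply/mem_pset_mul.
  exists (Some (phi (gen b))), (Some (phi (eta allS v))); split=> //.
    by rewrite mem_some_set inE.
  by rewrite /= etaM gmulfM.
(* Since some word has image [t], the bound [B t] cannot be the adjoined identity. *)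
have /asboolP[B1|[X gX BX]] := valP (B t).
  by have := inB _ u0t; rewrite B1 inE.
by exists X => // u /inB; rewrite BX mem_some_set.
Qed.

End Separation.

(** * Reducibility *)

Section SchutzWords.
Variables (A : finType) (T : finSemigroup) (psi : {multiplicative word A -> T}).

(** Letters get no cuts, so the second component of an image collects the cuts of the word. *)
Definition schutz_hom : {multiplicative word A -> schutz T} :=
  mkhom (word_extM (fun a => (psi (letter a), finset.set0) : schutz T)).

Lemma schutz_hom_fst u : (schutz_hom u).1 = psi u.
Proof.
elim/word_ind: u => [//|a u IHu].
by rewrite /= word_ext_cons /= gmulfM -IHu.
Qed.

Lemma schutz_hom_cut u a b : (a, b) \in (schutz_hom u).2 ->
  exists v w, [/\ u = v * w, psi v = a & psi w = b].
Proof.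
elim/word_ind: u a b => [c|c u IHu] a b; first by rewrite /= inE.
rewrite /= word_ext_cons => /mem_schutz_mul[[-> ->]|[d ub ->]|[d]].
- by exists (letter c), u; split=> //; rewrite -schutz_hom_fst.
- have [v [w [-> <- <-]]] := IHu _ _ ub.
  by exists (letter c * v), w; rewrite mulgA gmulfM.
- by rewrite inE.
Qed.

End SchutzWords.

(* If t = t * t in the Schuetzenberger product of T', then every word with image t
   is a product of two words with image t.1; n levels give n cuts. *)
Lemma idempotent_cuts (H : finGroupType -> Prop) (A : finType) (T : finSemigroup)
    (psi : {multiplicative word A -> T}) n : overline H T ->
  exists (T' : finSemigroup) (psi' : {multiplicative word A -> T'}),
  overline H T' /\ forall t, t * t = t -> exists s, forall u, psi' u = t ->
    psi u = s /\
    forall (S : finSemigroup) (f : {multiplicative word A -> S}) (Y : pset S),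
      (forall v, psi v = s -> f v \in (Y : {set S})) ->
      f u \in (spow Y n.+1 : {set S}).
Proof.
move=> VT; elim: n => [|n [T' [psi' [VT' IHn]]]].
  exists T, psi; split=> // t _; exists t => u ut; split=> // S f Y; exact.
exists (schutz T'), (schutz_hom psi'); split; first exact: overline_schutz.
move=> t tt; have [s sP] := IHn t.1 (congr1 fst tt); exists s => u ut.
have cut : (t.1, t.1) \in t.2 by rewrite -{3}tt; apply/mem_schutz_mul; constructor 1.
have ut1 : psi' u = t.1 by rewrite -schutz_hom_fst ut.
split=> [|S f Y YP]; first by have [] := sP u ut1.
have [v [w [-> vt wt]]] : exists v w, [/\ u = v * w, psi' v = t.1 & psi' w = t.1].
  by apply: schutz_hom_cut; rewrite ut.
rewrite spowS // gmulfM; apply/mem_pset_mul; exists (f v), (f w); split=> //.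
  by apply: YP; have [] := sP v vt.
by have [_] := sP w wt; apply.
Qed.

Section Reducible.
Variables (pi : set nat) (sigma : signature).
Notation V := (overline (G_ pi)).
Notation pi' := (negn [pred p | p \in pi]).
Hypothesis sigma_inv : sig_sub sigma (powop omega_pred).
Hypothesis sigma_root : has_roots pi sigma.

Section Phi.
Variables (A : finType) (S : finSemigroup).
Notation F := (completion allS (word A)).
Variable phi : {multiplicative F -> S}.
Hypothesis phi_cont : continuous (phi : _ -> discrete_topology S).

Definition phi_word : {multiplicative word A -> S} := phi \o eta allS.

Lemma phi_ev w : phi w = ev phi_word w.
Proof.
have : (phi : F -> discrete_topology S) = ev phi_word.
  by apply: eta_unique => // [|m]; [exact: ev_continuous | rewrite ev_eta].
exact: (congr1 (fun k => k w)).
Qed.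

(** Transported to an ordinal, [psi] is a coordinate of the free pro-V semigroup, and [t] is the
    value of [q] there. Each member of [P'] is replaced by a word with the same values in [S] and
    [T]. *)
Lemma lifts_image (P : set S) (P' : set F) (q : completion V (word A))
    (T : finSemigroup) (psi : {multiplicative word A -> T}) :
  phi @` P' = P -> @pV V _ @` P' = [set q] -> V T ->
  exists t, (q * q = q -> t * t = t) /\
    forall x, P x -> exists2 u, psi u = t & phi (eta allS u) = x.
Proof.
move=> phiP' pP' VT.
have VT' : V (ord_sg T).
  apply: (@overline_embed _ _ _ (mkhom (@of_ordM T))) VT.
  exact: enum_val_inj.
pose i : findex V (word A) := @Findex V (word A) #|T| (@ord_mul T) (@ord_mulA T) VT'
  (mkhom (@to_ordM T) \o psi).
exists (enum_val (coord i q)); split=> [qq|x].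
  have e : coord i q * coord i q = coord i q by rewrite -coordM qq.
  exact: etrans (esym (@of_ordM T (coord i q) (coord i q))) (congr1 _ e).
rewrite -phiP' => -[w P'w <-].
have qw : @pV V _ w = q.
  by have : (@pV V _ @` P') (@pV V _ w) by [exists w]; rewrite pP'.
have [u [phiu psiu]] := ev_image2 phi_word psi w.
exists u; first by rewrite -psiu -qw.
by rewrite [RHS]phi_ev phiu.
Qed.

(** All terms over [P] with the projection of one fixed lift [w0] are taken; this projection has the
    coordinates [r]. *)
Lemma good_subset_lifts (P : set S) (r : forall i, fi_sg i) :
  P !=set0 -> (forall x, P x -> lifted sigma phi r x) ->
  exists2 P', P' `<=` @sig_sub sigma A & exists q : completion V (word A),
    [/\ phi @` P' = P, @pV V _ @` P' = [set q] & forall i, coord i q = r i].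
Proof.
move=> [x0 Px0] Pr; have [w0 [sw0 phiw0 w0r]] := Pr x0 Px0.
exists [set w | [/\ sig_sub sigma w, P (phi w) & @pV V _ w = @pV V _ w0]].
  by move=> w [].
exists (@pV V _ w0); split=> //.
  apply/seteqP; split=> [_ [w [_ Pw _] <-]//|x Px].
  have [w [sw phiw wr]] := Pr x Px; exists w => //; split; rewrite ?phiw //.
  by apply: completion_eq => i; rewrite -[LHS]/(coord i _) wr -w0r.
apply/seteqP; split=> [_ [w [_ _ <-] <-]//|_ ->].
by exists w0 => //; split; rewrite ?phiw0.
Qed.

End Phi.

Lemma reducible_pointlike_overline : reducible_pointlike sigma V.
Proof.
move=> S P [P0 Plift] A phi phi_onto; have [phi_cont _] := phi_onto.
have [P' [phiP' [q pP']]] := Plift A phi phi_onto.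
have [T [psi [VT psiP]]] := separation phi_cont sigma_inv sigma_root.
have [t [_ tP]] := lifts_image phi_cont psi phiP' pP' VT.
have [|X [_ [r rX]] XP] := psiP t.
  by have [x /tP[u ut _]] := P0; exists u.
have Pr x : P x -> lifted sigma phi r x.
  by move=> /tP[u ut <-]; apply: rX; exact: XP.
have [P'' sP'' [q' [phiP'' pP'' _]]] := good_subset_lifts P0 Pr.
by exists P'' => //; split=> //; exists q'.
Qed.

Lemma reducible_idem_pointlike_overline : reducible_idem_pointlike sigma V.
Proof.
move=> S P [P0 Plift] A phi phi_onto; have [phi_cont _] := phi_onto.
have [P' [phiP' [q qq pP']]] := Plift A phi phi_onto.
have [T [psi [VT psiP]]] := separation phi_cont sigma_inv sigma_root.
(* This exponent makes [X^N] idempotent; [N - 1] cuts give [N] factors. *)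
pose N := (#|pset S|) `!; have N0 : 0 < N by exact: fact_gt0.
have [T' [psi' [VT' cuts]]] := idempotent_cuts psi N.-1 VT.
have [t [tt tP]] := lifts_image phi_cont psi' phiP' pP' VT'.
have [s sP] := cuts t (tt qq).
have [|X gX XP] := psiP s.
  by have [x /tP[u /sP[us _] _]] := P0; exists u.
pose E : pset S := spow (X : pset S) N.
have EE : E * E = E.
  rewrite /E -spowD //; apply: spow_eqmod_fact; rewrite ?leq_addr //.
  by rewrite modnDr modnn.
have gE : good pi sigma phi E by exact: good_spow.
(* An idempotent set generates a trivial group, so [n = 1] applies and the common projection is
   idempotent. *)
have [|r rr rE] := good_powers phi_cont sigma_inv sigma_root gE (n := 1) _ EE.
  by [].
have Pr x : P x -> lifted sigma phi r x.
  move=> /tP[u ut <-]; apply: (rE 1%N) => //.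
  have [_ /(_ S (phi_word phi) X)] := sP u ut; rewrite prednK //; apply.
  by move=> v vs; exact: XP.
have [P'' sP'' [q' [phiP'' pP'' q'r]]] := good_subset_lifts P0 Pr.
exists P'' => //; split=> //; exists q' => //.
by apply: completion_eq => i; rewrite -[LHS]/(coord i _ * coord i _) q'r rr -q'r.
Qed.

End Reducible.

Lemma aperiodic_overline : aperiodic = overline (G_ set0).
Proof.
apply: funext => S; apply: propext.
have G1 (G : finGroupType) : #|G| = 1%N <-> G_ set0 G.
  rewrite /G_; split=> [->//|].
  move=> Gn; apply: (pnat_1 Gn); apply/pnatP => [|p _ _]; first by case/andP: Gn.
  by rewrite !inE; apply/negP => /set_mem.
by split=> VS G i /(VS G i) /G1.
Qed.

Theorem corollary3p2 :
  (forall (pi : set nat) (nu : Zhat),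
     (forall p, pi p -> prime p) -> is_nu pi nu ->
     reducible_pointlike (kappa_pi nu) (overline (G_ pi)) /\
     reducible_idem_pointlike (kappa_pi nu) (overline (G_ pi))) /\
  reducible_pointlike kappa aperiodic /\
  reducible_idem_pointlike kappa aperiodic.
Proof.
have kappa_inv : sig_sub kappa (powop omega_pred).
  by apply: sig_sub_powop; exact: Kappa_inv.
split=> [pi nu pi_prime nuP|].
  have mono n : kappa n `<=` kappa_pi nu n by move=> w; exact: Kappa_pi_kappa.
  have sigma_inv := sig_sub_mono mono kappa_inv.
  suff sigma_root : has_roots pi (kappa_pi nu).
    by split; [exact: reducible_pointlike_overline |
      exact: reducible_idem_pointlike_overline].
  move=> k kP; have [mu muE] := exists_mu pi_prime nuP kP; exists mu.
    have [|nkappa] := pselect (sig_sub kappa (powop mu)); first exact: sig_sub_mono.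
    apply: sig_sub_powop; apply: Kappa_pi_pow nkappa.
    by exists k => //; case/andP: kP.
  move=> T t VT; rewrite -(nu_omega_pred pi_prime nuP t VT).
  rewrite -[RHS]evM -muE -[RHS]/(mkhom (@evM _ _ (Zplus_pow t)) _) spow_hom /=.
  by rewrite evM ev_eta /= /Zplus_pow posnK.
rewrite aperiodic_overline.
suff sigma_root : has_roots set0 kappa.
  by split; [exact: reducible_pointlike_overline |
    exact: reducible_idem_pointlike_overline].
(* In an aperiodic semigroup all powers from [|T|!] on coincide, so omega - 1 itself yields the
   roots. *)
move=> k /andP[k0 _]; exists omega_pred => // T t VT.
have N0 := fact_gt0 #|T|; have NM := pred_2fact #|T|.
have M0 := leq_trans N0 NM.
have tN a : (#|T|) `! <= a -> spow t a = spow t ((#|T|) `!).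
  have [d dP dN] := overline_period t VT.
  have d1 : d = 1%N.
    apply: (pnat_1 dP); apply/pnatP => [|p _ _]; first by case/andP: dP.
    by rewrite !inE; apply/negP => /set_mem.
  move=> Na; rewrite -{1}(subnKC Na) -[(a - _)%N]mul1n -d1.
  exact: spow_period_mul N0 dN (leqnn _).
rewrite !ev_zlim -spowSr // -spowM // !tN //.
by rewrite (leq_trans NM) // (leq_trans (leqnSn _)) // leq_pmulr.
Qed.
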